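(* Let $\alpha\in(0,1)$, $\alpha\ne1/n$ for all $n\in\mathbb N$, and $0<\beta<\alpha$. Let $E^{\alpha,\beta}=\bigsqcup_{\mathbf X\in\mathscr C^\alpha}\mathscr D^{\alpha,\beta}_{\mathbf X}$ and $E^{\alpha,\beta}_g=\bigsqcup_{\mathbf X\in\mathscr C^\alpha_g}\mathscr D^{\alpha,\beta}_{\mathbf X}$, with canonical projection $p$ onto the controlling rough path, and let $E$ be either of these. Equip $E$ with the flat metric $$d^\flat_\alpha(x,y)=\rho_\alpha(p(x),p(y))+|||x;y|||_\alpha .$$ Then $(E,d^\flat_\alpha)$ is complete. In particular, $(E^{\alpha,\beta}_g,d^\flat_\alpha)$ is a Polish space, while $(E^{\alpha,\beta},d^\flat_\alpha)$ is a complete metric space.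
   Context: Forests. $A$ is a fixed finite nonempty set. $\mathcal F$ is the set of forests (commutative monomials of non-planar rooted trees with nodes labelled by $A$), including the empty forest $\mathbf 1$; $\mathcal H$ is the real vector space with basis $\mathcal F$, i.e. the polynomial algebra on trees. $|h|$ is the number of nodes of $h\in\mathcal F$; $\mathcal F_{(n)}=\{h\in\mathcal F:|h|\le n\}$, $\mathcal F^+_{(n)}=\mathcal F_{(n)}\setminus\{\mathbf 1\}$. For $a\in A$, $[h]_a$ is the tree obtained by grafting the trees of $h$ on a new root labelled $a$. The coproduct $\Delta:\mathcal H\to\mathcal H\otimes\mathcal H$ is the algebra morphism with $\Delta[h]_a=(\mathrm{id}\otimes[\cdot]_a)\Delta h+[h]_a\otimes\mathbf 1$. On $\mathcal H^*$, $\langle\phi\star\psi,h\rangle=\langle\phi\otimes\psi,\Delta h\rangle$. A forest $h$ is identified with the functional $h'\mapsto\delta_{h,h'}$, so $\bar h\star h$ is a finite linear combination of forests. Rough paths. $T>0$ is fixed; $N=\lfloor1/\alpha\rfloor$. An $\alpha$-branched rough path is a family $\mathbf X=(\mathbf X_{s,t})_{s,t\in[0,T]}$ of characters (unital multiplicative linear functionals) of $\mathcal H$ with $\mathbf X_{s,u}\star\mathbf X_{u,t}=\mathbf X_{s,t}$ and $\sup_{s\ne t}|\langle\mathbf X_{s,t},h\rangle|/|t-s|^{\alpha|h|}<\infty$ for all $h\in\mathcal F$. Write $\mathbf X^h_{s,t}=\langle\mathbf X_{s,t},h\rangle$ and $\|F\|_\gamma=\sup_{s\neq t}|F_{s,t}|/|t-s|^\gamma$.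 $\mathscr C^\alpha$ is the set of all of them, with the metric $\rho_\alpha(\mathbf X,\tilde{\mathbf X})=\max_{h\in\mathcal F^+_{(N)}}\|\mathbf X^h-\tilde{\mathbf X}^h\|_{|h|\alpha}$. The canonical lift of a smooth path $x:[0,T]\to\mathbb R^A$ is the family of characters given recursively by $\mathbf X^{[h]_a}_{s,t}=\int_s^t\mathbf X^h_{s,r}\,dx^a_r$ and multiplicativity. $\mathscr C^\alpha_g\subset\mathscr C^\alpha$ is the closed subspace of geometric rough paths: the $\rho_\alpha$-closure of the set of canonical lifts of smooth paths. Controlled paths. For a path $\mathbf Z:[0,T]\to\mathrm{span}\,\mathcal F_{(N-1)}$ and $h\in\mathcal F_{(N-1)}$ put $R^h_{s,t}=\langle h,\mathbf Z_t\rangle-\langle\mathbf X_{s,t}\star h,\mathbf Z_s\rangle$, and for $0<\gamma\le\alpha$ put $|||\mathbf Z|||_\gamma=\sum_{h\in\mathcal F_{(N-1)}}(|\langle h,\mathbf Z_0\rangle|+\|R^h\|_{(N-|h|)\gamma})$ (always with $N=\lfloor 1/\alpha\rfloor$). $\mathscr D^\alpha_{\mathbf X}$ is the space of $\mathbf Z$ with $|||\mathbf Z|||_\alpha<\infty$, and $\mathscr D^{\alpha,\beta}_{\mathbf X}$ is the closure of $\mathscr D^\alpha_{\mathbf X}$ under $|||\cdot|||_\beta$. For $\mathbf Z,\tilde{\mathbf Z}$ controlled by $\mathbf X,\tilde{\mathbf X}$ with remainders $R^h,\tilde R^h$ (each with respect to its own rough path), $|||\mathbf Z;\tilde{\mathbf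 Z}|||_\alpha=\sum_{h\in\mathcal F_{(N-1)}}(|\langle h,\mathbf Z_0-\tilde{\mathbf Z}_0\rangle|+\|R^h-\tilde R^h\|_{(N-|h|)\alpha})$.
   Formalization: With |||x;y|||_α the distance can be infinite and E_g is not separable, so for exponent α only ''complete extended metric'' is proved (for both spaces); the Polish and complete metric space claims are proved with |||x;y|||_β in place of |||x;y|||_α. *)

(* Defs.v *)
From HB Require Import structures.
From mathcomp Require Import all_boot all_order all_algebra generic_quotient.
From mathcomp Require Import all_classical all_reals all_analysis.

Set Implicit Arguments.
Unset Strict Implicit.
Unset Printing Implicit Defensive.

Import Order.TTheory GRing.Theory Num.Theory.
Import numFieldNormedType.Exports.

Local Open Scope classical_set_scope.
Local Open Scope quotient_scope.
Local Open Scope ring_scope.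

Inductive ptree (A : Type) := PNode of A & seq (ptree A).

Section PlanarTrees.
Variable A : Type.

Lemma ptree_seq_rect (P : ptree A -> Type) (Q : seq (ptree A) -> Type) :
  Q [::] -> (forall t f, P t -> Q f -> Q (t :: f)) ->
  (forall a f, Q f -> P (PNode a f)) -> (forall t, P t) * (forall f, Q f).
Proof.
move=> Q0 Qc PN.
pose F := fix F t : P t := let: PNode a f := t in PN a f
  ((fix G f : Q f := if f is u :: g then Qc u g (F u) (G g) else Q0) f).
split; first exact: F.
elim=> [|u g IH]; [exact: Q0 | exact: (Qc u g (F u) IH)].
Qed.

Fixpoint ptree_enc (t : ptree A) : GenTree.tree A :=
  let: PNode a f := t in GenTree.Node 0 (GenTree.Leaf a :: map ptree_enc f).

Fixpoint ptree_dec (t : GenTree.tree A) : option (ptree A) :=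
  if t is GenTree.Node _ (GenTree.Leaf a :: f) then
    Some (PNode a (pmap ptree_dec f))
  else None.

Lemma ptree_encK : pcancel ptree_enc ptree_dec.
Proof.
apply: (ptree_seq_rect (P := fun t => ptree_dec (ptree_enc t) = Some t)
  (Q := fun f => pmap ptree_dec (map ptree_enc f) = f) _ _ _).1.
- by [].
- by move=> t f /= -> /= ->.
- by move=> a f /= ->.
Qed.

Fixpoint tsize (t : ptree A) : nat :=
  let: PNode _ f := t in (sumn (map tsize f)).+1.

Definition pfsize (f : seq (ptree A)) : nat := sumn (map tsize f).

(* Equality of planar forests up to reordering, at every level, of the trees of a
   forest and of the branches at a node. *)
Inductive reorder : seq (ptree A) -> seq (ptree A) -> Prop :=
| reorder_nil : reorder [::] [::]
| reorder_cons a f g s t :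
    reorder f g -> reorder s t -> reorder (PNode a f :: s) (PNode a g :: t)
| reorder_swap t u s : reorder (t :: u :: s) (u :: t :: s)
| reorder_trans f g h : reorder f g -> reorder g h -> reorder f h.

Lemma reorder_refl f : reorder f f.
Proof.
apply: (ptree_seq_rect (Q := fun f => reorder f f)
  (P := fun t => let: PNode _ f := t in reorder f f) _ _ _).2.
- exact: reorder_nil.
- by move=> [a g] s Hg Hs; exact: reorder_cons.
- by [].
Qed.

Lemma reorder_sym f g : reorder f g -> reorder g f.
Proof.
elim=> {f g} [|a f g s t _ Hf _ Hs|t u s|f g h _ Hf _ Hg].
- exact: reorder_nil.
- exact: reorder_cons.
- exact: reorder_swap.
- exact: (reorder_trans Hg Hf).
Qed.

Lemma reorder_catl f g h : reorder f g -> reorder (f ++ h) (g ++ h).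
Proof.
elim=> {f g} [|a f g s t Hf _ _ Hs|t u s|f g k _ Hf _ Hg] /=.
- exact: reorder_refl.
- exact: reorder_cons.
- exact: reorder_swap.
- exact: (reorder_trans Hf Hg).
Qed.

Lemma reorder_tail t f g : reorder f g -> reorder (t :: f) (t :: g).
Proof. by case: t => a h; apply: reorder_cons; exact: reorder_refl. Qed.

Lemma reorder_catr f g h : reorder f g -> reorder (h ++ f) (h ++ g).
Proof. by move=> fg; elim: h => //= t h; exact: reorder_tail. Qed.

Lemma reorder_catC f g : reorder (f ++ g) (g ++ f).
Proof.
elim: f g => [|t f IH] g; first by rewrite cats0; exact: reorder_refl.
apply: (reorder_trans (reorder_tail t (IH g))).
elim: g => [|u g IHg] /=; first exact: reorder_refl.
exact: (reorder_trans (reorder_swap _ _ _) (reorder_tail u IHg)).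
Qed.

Lemma reorder_pfsize f g : reorder f g -> pfsize f = pfsize g.
Proof.
rewrite /pfsize.
elim=> {f g} [//|a f g s t _ Hf _ Hs|t u s|f g h _ -> _ ->//] /=.
- by rewrite Hf Hs.
- by rewrite addnCA.
Qed.

End PlanarTrees.

HB.instance Definition _ (A : eqType) :=
  Equality.copy (ptree A) (pcan_type (@ptree_encK A)).
HB.instance Definition _ (A : choiceType) :=
  Choice.copy (ptree A) (pcan_type (@ptree_encK A)).
HB.instance Definition _ (A : countType) :=
  Countable.copy (ptree A) (pcan_type (@ptree_encK A)).

Section Forests.
Variable A : countType.

Definition reorderb (f g : seq (ptree A)) : bool := `[< reorder f g >].

Lemma reorderb_refl : reflexive reorderb.
Proof. by move=> f; apply/asboolP; exact: reorder_refl. Qed.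

Lemma reorderb_sym : symmetric reorderb.
Proof. by move=> f g; apply/asboolP/asboolP; exact: reorder_sym. Qed.

Lemma reorderb_trans : transitive reorderb.
Proof.
move=> g f h /asboolP fg /asboolP gh; apply/asboolP.
exact: reorder_trans fg gh.
Qed.

Canonical reorder_equiv :=
  EquivRel reorderb reorderb_refl reorderb_sym reorderb_trans.

Definition forest := {eq_quot reorder_equiv}.
HB.instance Definition _ := Countable.on forest.
HB.instance Definition _ := EqQuotient.on forest.

Implicit Types (f g : seq (ptree A)) (h k : forest).

Lemma forest_piP f g : \pi_forest f = \pi_forest g <-> reorder f g.
Proof.
split=> [/eqmodP/asboolP //|fg]; by apply/eqmodP/asboolP.
Qed.

Lemma repr_forest_piP f : reorder (repr (\pi_forest f)) f.
Proof. by apply/forest_piP; rewrite reprK. Qed.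

Definition fone : forest := \pi_forest [::].
Definition fmul h k : forest := \pi_forest (repr h ++ repr k).
Definition graft (a : A) h : forest := \pi_forest [:: PNode a (repr h)].
Definition fsize h : nat := pfsize (repr h).

Lemma fmul_pi f g : fmul (\pi_forest f) (\pi_forest g) = \pi_forest (f ++ g).
Proof.
apply/forest_piP; apply: (reorder_trans (reorder_catl _ (repr_forest_piP f))).
exact: reorder_catr (repr_forest_piP g).
Qed.

Lemma graft_pi a f : graft a (\pi_forest f) = \pi_forest [:: PNode a f].
Proof.
apply/forest_piP; apply: reorder_cons; [exact: repr_forest_piP | exact: reorder_nil].
Qed.

Lemma fsize_pi f : fsize (\pi_forest f) = pfsize f.
Proof. exact/reorder_pfsize/repr_forest_piP. Qed.

Lemma forestW (P : forest -> Prop) : (forall f, P (\pi_forest f)) -> forall h, P h.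
Proof. by move=> Pf h; rewrite -[h]reprK. Qed.

Lemma fmulC : commutative fmul.
Proof.
elim/forestW=> f; elim/forestW=> g; rewrite !fmul_pi.
by apply/forest_piP; exact: reorder_catC.
Qed.

Lemma fmulA : associative fmul.
Proof.
elim/forestW=> f; elim/forestW=> g; elim/forestW=> k.
by rewrite !fmul_pi catA.
Qed.

Lemma fmul1f : left_id fone fmul.
Proof. by elim/forestW=> f; rewrite /fone fmul_pi. Qed.

Lemma fsize1 : fsize fone = 0.
Proof. by rewrite /fone fsize_pi. Qed.

Lemma fsizeM h k : fsize (fmul h k) = (fsize h + fsize k)%N.
Proof.
elim/forestW: h => f; elim/forestW: k => g.
by rewrite fmul_pi !fsize_pi /pfsize map_cat sumn_cat.
Qed.

Lemma fsize_graft a h : fsize (graft a h) = (fsize h).+1.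
Proof.
by elim/forestW: h => f; rewrite graft_pi !fsize_pi /pfsize /= addn0.
Qed.

(* The pure tensors h1 (x) h2 form a basis of H (x) H, and the coefficients of a
   coproduct in it are natural numbers: it is encoded as the list of its pairs
   (h1, h2), repeated according to their multiplicity. *)
Definition tmul (s t : seq (forest * forest)) : seq (forest * forest) :=
  [seq (fmul p.1 q.1, fmul p.2 q.2) | p <- s, q <- t].

Fixpoint tcoprod (t : ptree A) : seq (forest * forest) :=
  let: PNode a f := t in
  (\pi_forest [:: PNode a f], fone) ::
    [seq (p.1, graft a p.2) | p <- foldr tmul [:: (fone, fone)] (map tcoprod f)].

Definition pfcoprod f : seq (forest * forest) :=
  foldr tmul [:: (fone, fone)] (map tcoprod f).

Definition coprod h : seq (forest * forest) := pfcoprod (repr h).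

Lemma tmulC s t : perm_eq (tmul s t) (tmul t s).
Proof.
rewrite /tmul; elim: s => [|x s IH]; first by rewrite allpairs0r.
rewrite allpairs_cons perm_sym perm_allpairs_consr perm_sym.
have -> : [seq (fmul x.1 q.1, fmul x.2 q.2) | q <- t] =
    [seq (fmul p.1 x.1, fmul p.2 x.2) | p <- t].
  by apply: eq_map => q; rewrite (fmulC x.1) (fmulC x.2).
by rewrite perm_cat2l.
Qed.

Lemma tmulA : associative tmul.
Proof.
move=> s t u; rewrite /tmul; elim: s => //= x s IH.
rewrite IH allpairs_cat; congr (_ ++ _).
rewrite allpairs_mapl map_allpairs.
by apply/eq_in_allpairs_dep => p _ q _ /=; rewrite !fmulA.
Qed.

Lemma perm_tmul s s' t t' :
  perm_eq s s' -> perm_eq t t' -> perm_eq (tmul s t) (tmul s' t').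
Proof. exact: perm_allpairs. Qed.

Lemma tmulf1 s : tmul [:: (fone, fone)] s = s.
Proof.
rewrite /tmul allpairs1l -[RHS]map_id.
by apply: eq_map => -[x y]; rewrite /= !fmul1f.
Qed.

Lemma pfcoprod_cat f g : pfcoprod (f ++ g) = tmul (pfcoprod f) (pfcoprod g).
Proof.
rewrite /pfcoprod; elim: f => [|t f IH] /=; first by rewrite tmulf1.
by rewrite IH tmulA.
Qed.

Lemma pfcoprod_reorder f g :
  reorder f g -> perm_eq (pfcoprod f) (pfcoprod g).
Proof.
elim=> {f g} [|a f g s t fg Hf _ Hs|t u s|f g h _ Hf _ Hg] //.
- rewrite /pfcoprod /=; apply: perm_tmul Hs => /=.
  have -> : \pi_forest [:: PNode a f] = \pi_forest [:: PNode a g].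
    by apply/forest_piP; apply: reorder_cons fg _; exact: reorder_nil.
  by rewrite perm_cons; exact: perm_map.
- rewrite /pfcoprod /= !tmulA; apply: perm_tmul => //; exact: tmulC.
- exact: perm_trans Hf Hg.
Qed.

Lemma coprod_pi f : perm_eq (coprod (\pi_forest f)) (pfcoprod f).
Proof. exact/pfcoprod_reorder/repr_forest_piP. Qed.

Lemma coprod1 : perm_eq (coprod fone) [:: (fone, fone)].
Proof. exact: coprod_pi. Qed.

Lemma coprodM h k : perm_eq (coprod (fmul h k)) (tmul (coprod h) (coprod k)).
Proof. by rewrite /coprod -pfcoprod_cat; exact: coprod_pi. Qed.

Lemma coprod_graft a h :
  perm_eq (coprod (graft a h))
    ((graft a h, fone) :: [seq (p.1, graft a p.2) | p <- coprod h]).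
Proof.
apply: (perm_trans (coprod_pi _)); rewrite /pfcoprod /= /coprod /pfcoprod.
set s := (X in tmul X _); rewrite (perm_trans (tmulC s _)) // tmulf1.
exact: perm_refl.
Qed.

Definition forests_le (n : nat) : set forest := [set h | (fsize h <= n)%N].
Definition forests_le_pos (n : nat) : set forest := forests_le n `\ fone.

End Forests.

Arguments fone {A}.

Section RoughPaths.
Variables (R : realType) (A : finType) (T : {posnum R}).

Definition time : Type := {t : R | 0 <= t <= T%:num}.

Lemma time0_subproof : (0 : R) <= 0 <= T%:num.
Proof. by rewrite lexx ge0. Qed.

Definition time0 : time := exist _ 0 time0_subproof.

(* A linear functional on H is given by its values on the basis of forests. *)
Definition functional : Type := forest A -> R.

Definition character (phi : functional) : Prop :=
  phi fone = 1 /\ forall h k, phi (fmul h k) = phi h * phi k.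

Definition star (phi psi : functional) : functional :=
  fun h => \sum_(p <- coprod h) phi p.1 * psi p.2.

Definition dirac_forest (h : forest A) : functional := fun k => (k == h)%:R.

Definition holder (gamma : R) (F : time -> time -> R) : \bar R :=
  ereal_sup [set (`|F p.1 p.2| / `|val p.2 - val p.1| `^ gamma)%:E
            | p in [set p : time * time | p.1 != p.2]].

Definition process : Type := time -> time -> functional.

Definition branched_rough_paths (alpha : R) : set process := [set X |
  [/\ forall s t, character (X s t),
      forall s u t, star (X s u) (X u t) = X s t
    & forall h, (holder (alpha * (fsize h)%:R) (fun s t => X s t h) < +oo)%E]].

Definition level (alpha : R) : nat := Num.truncn (1 / alpha).

Definition rho (alpha : R) (X Y : process) : \bar R :=
  ereal_sup [set holder ((fsize h)%:R * alpha) (fun s t => X s t h - Y s t h)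
            | h in forests_le_pos (level alpha)].

(* \int_s^t f(r) dr, with the usual sign when t < s. *)
Definition oriented_integral (s t : R) (f : R -> R) : R :=
  if s <= t then \int[lebesgue_measure]_(r in `[s, t]) f r
  else - \int[lebesgue_measure]_(r in `[t, s]) f r.

(* A smooth path on [0, T] is the restriction of a smooth map on R; only the
   values on [0, T] matter below. *)
Definition smooth (x : A -> R -> R) : Prop :=
  forall a n t, derivable ((x a)^`(n))%classic t 1.

(* [insub r : option time] is [Some] of r exactly when r is in [0, T], as it is
   throughout the range of integration. *)
Definition canonical_lift (x : A -> R -> R) (X : process) : Prop :=
  (forall s t, character (X s t)) /\
  forall a h s t, X s t (graft a h) =
    oriented_integral (val s) (val t)
      (fun r => oapp (fun u : time => X s u h) 0 (insub r) * (x a)^`()%classic r).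

Definition geometric_rough_paths (alpha : R) : set process := [set X |
  branched_rough_paths alpha X /\
  forall e : R, 0 < e -> exists x Y,
    [/\ smooth x, canonical_lift x Y & (rho alpha X Y < e%:E)%E]].

(* Elements of H are identified with their families of coefficients. *)
Definition hpath : Type := time -> forest A -> R.

Definition path_in_span (n : nat) (Z : hpath) : Prop :=
  forall t h, ~ forests_le n h -> Z t h = 0.

(* <phi, z> for z in span F_(n) *)
Definition pairing (n : nat) (phi : functional) (z : forest A -> R) : R :=
  \sum_(h \in forests_le n) phi h * z h.

Definition remainder (alpha : R) (X : process) (Z : hpath) (h : forest A) :
    time -> time -> R := fun s t =>
  Z t h - pairing (level alpha).-1 (star (X s t) (dirac_forest h)) (Z s).

Definition cnorm (alpha gamma : R) (X : process) (Z : hpath) : \bar R :=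
  (\sum_(h \in @forests_le A (level alpha).-1)
    (`|Z time0 h|%:E +
     holder ((level alpha - fsize h)%N%:R * gamma)%R (remainder alpha X Z h)))%E.

Definition controlled (alpha : R) (X : process) : set hpath := [set Z |
  path_in_span (level alpha).-1 Z /\ (cnorm alpha alpha X Z < +oo)%E].

Definition controlled_closure (alpha beta : R) (X : process) : set hpath :=
  [set Z | path_in_span (level alpha).-1 Z /\
    forall e : R, 0 < e -> exists2 W, controlled alpha X W &
      (cnorm alpha beta X (fun t h => Z t h - W t h)%R < e%:E)%E].

Definition cdist (alpha gamma : R) (X Y : process) (Z W : hpath) : \bar R :=
  (\sum_(h \in @forests_le A (level alpha).-1)
    (`|Z time0 h - W time0 h|%R%:E +
     holder ((level alpha - fsize h)%N%:R * gamma)%R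
       (fun s t => remainder alpha X Z h s t - remainder alpha Y W h s t)%R))%E.

Definition total_space (C : set process) (alpha beta : R) :
    set (process * hpath) :=
  [set x | C x.1 /\ controlled_closure alpha beta x.1 x.2].

(* gamma is the exponent in which the fibre components are compared. For
   gamma = beta this is the norm in which the fibres of [total_space] are closed
   and the distance is finite; for gamma = alpha it can be infinite, since an
   element of [controlled_closure alpha beta X] need not be alpha-controlled. *)
Definition flat_dist (alpha gamma : R) (x y : process * hpath) : \bar R :=
  (rho alpha x.1 y.1 + cdist alpha gamma x.1 y.1 x.2 y.2)%E.

End RoughPaths.

Section Metric.
Variables (R : realType) (S : Type).
Implicit Types (E : set S) (d : S -> S -> \bar R).

Definition extended_metric_on E d : Prop :=
  [/\ forall x y, E x -> E y -> (0 <= d x y)%E,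
      forall x y, E x -> E y -> (d x y = 0%E <-> x = y),
      forall x y, E x -> E y -> d x y = d y x
    & forall x y z, E x -> E y -> E z -> (d x z <= d x y + d y z)%E].

Definition metric_on E d : Prop :=
  extended_metric_on E d /\ forall x y, E x -> E y -> (d x y < +oo)%E.

Definition complete_on E d : Prop :=
  forall u : nat -> S, (forall n, E (u n)) ->
    (forall e : R, 0 < e -> exists n0, forall m n,
      (n0 <= m)%N -> (n0 <= n)%N -> (d (u m) (u n) < e%:E)%E) ->
    exists2 l, E l & forall e : R, 0 < e -> exists n0, forall n,
      (n0 <= n)%N -> (d (u n) l < e%:E)%E.

Definition separable_on E d : Prop :=
  exists D : set S, [/\ D `<=` E, countable D &
    forall x, E x -> forall e : R, 0 < e -> exists2 y, D y & (d x y < e%:E)%E].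

Definition complete_metric_on E d : Prop := metric_on E d /\ complete_on E d.

Definition polish_on E d : Prop := complete_metric_on E d /\ separable_on E d.

End Metric.

(* Main.v *)
(* Write N = floor(1/alpha), n = N - 1 and let G_{st} act on families of coefficients by
   (G_{st} z)_h = <X_{st} * h, z>.  Coassociativity gives G_{ut} G_{su} = G_{st}, and the
   remainder of a controlled path is Z_t - G_{st} Z_s = G_{0t} (Y_t - Y_s), where
   Y_t = G_{t0} Z_t is Z seen in a moving frame.

   Completeness, rough paths.  A difference D of two rough paths at a level h with
   alpha |h| > 1 is controlled by the lower levels: it is a priori Hoelder of exponent
   alpha |h|, so one midpoint subdivision bounds its norm by a multiple of its defect of
   additivity.  Hence a rho-Cauchy sequence is Cauchy at all levels.

   Completeness, fibres.  The remainders converge, and the only issue is that the limit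
   stays in the closure of the alpha-controlled paths.  That closure is
   { Z : R^h_{st} = o(|t-s|^{(N-|h|) beta}) uniformly }, a condition which passes to the
   limit.  To approximate such a Z by an alpha-controlled path, interpolate Y linearly on
   a fine grid: the remainders become O(|t-s|), and this is enough because
   alpha is not the inverse of an integer, so that (N-|h|) alpha < 1.

   Separability.  Geometric rough paths satisfy X^h_{st} = o(|t-s|^{alpha |h|}) as well.
   A scale below which all these quantities are small, together with their values
   rounded at the nodes of a fine enough grid, determines a point of the total space up
   to epsilon, and there are countably many such data. *)
Require Import Defs.
From mathcomp Require Import all_boot all_order all_algebra generic_quotient.
From mathcomp Require Import all_classical all_reals all_analysis.
From mathcomp Require Import finmap zify ring lra.

Set Implicit Arguments.
Unset Strict Implicit.
Unset Printing Implicit Defensive.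

Import Order.TTheory GRing.Theory Num.Theory.
Import numFieldNormedType.Exports.

Local Open Scope classical_set_scope.
Local Open Scope quotient_scope.
Local Open Scope ring_scope.

(** * Forests and their coproduct *)

Section Forests.
Variable A : countType.
Implicit Types h k : forest A.

(** Identities for the coproduct can thus be checked on its defining relations (unit, graft,
    product), without choosing representatives. *)
Lemma forest_ind (P : forest A -> Prop) :
  P fone -> (forall a h, P h -> P (graft a h)) ->
  (forall h k, P h -> P k -> P (fmul h k)) -> forall h, P h.
Proof.
move=> P1 Pg Pm; elim/forestW => f.
apply: (ptree_seq_rect (P := fun t => P (\pi_(forest A) [:: t]))
  (Q := fun f => P (\pi_(forest A) f)) _ _ _).2.
- exact: P1.
- by move=> t g Pt Qg; rewrite -cat1s -fmul_pi; exact: Pm.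
- by move=> a g Qg; rewrite -graft_pi; exact: Pg.
Qed.

Lemma fsize_eq0 h : (fsize h == 0)%N = (h == fone).
Proof.
apply/eqP/eqP => [|->]; last exact: fsize1.
elim/forestW: h => f; rewrite fsize_pi /fone.
by case: f => [|[a g] f] //; rewrite /pfsize /=; lia.
Qed.

Lemma fsize_gt0 h : (0 < fsize h)%N = (h != fone).
Proof. by rewrite lt0n fsize_eq0. Qed.

Lemma fmul_eq1 h k : (fmul h k == fone) = (h == fone) && (k == fone).
Proof. by rewrite -!fsize_eq0 fsizeM addn_eq0. Qed.

Lemma graft_neq1 (a : A) h : (graft a h == fone) = false.
Proof. by rewrite -fsize_eq0 fsize_graft. Qed.

Lemma fmulf1 h : fmul h fone = h.
Proof. by rewrite fmulC fmul1f. Qed.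

Section Sums.
Variables (V : nmodType) (F : forest A * forest A -> V).

Lemma sum_coprod1 : \sum_(p <- coprod fone) F p = F (fone, fone).
Proof. by rewrite (perm_big _ (coprod1 A)) big_seq1. Qed.

Lemma sum_coprodM h k : \sum_(p <- coprod (fmul h k)) F p =
  \sum_(p <- coprod h) \sum_(q <- coprod k) F (fmul p.1 q.1, fmul p.2 q.2).
Proof. by rewrite (perm_big _ (coprodM h k)) big_allpairs_dep. Qed.

Lemma sum_coprod_graft (a : A) h : \sum_(p <- coprod (graft a h)) F p =
  F (graft a h, fone) + \sum_(p <- coprod h) F (p.1, graft a p.2).
Proof. by rewrite (perm_big _ (coprod_graft a h)) big_cons big_map. Qed.

End Sums.

Lemma coprod_fsize h p :
  p \in coprod h -> (fsize p.1 + fsize p.2 = fsize h)%N.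
Proof.
elim/forest_ind: h p => [|a h IH|h k IHh IHk] p.
- by rewrite (perm_mem (coprod1 A)) inE => /eqP -> /=; rewrite fsize1.
- rewrite (perm_mem (coprod_graft a h)) inE => /orP[/eqP -> /=|].
    by rewrite fsize1 addn0.
  by case/mapP => q /IH qh -> /=; rewrite !fsize_graft -qh addnS.
- rewrite (perm_mem (coprodM h k)) => /allpairsP[[q r] /= [/IHh qh /IHk rk ->]].
  by rewrite /= !fsizeM -qh -rk addnACA.
Qed.

(** Counit axiom: the pair with the unit on the left occurs exactly once. An arbitrary summand [F]
    lets the induction absorb grafts and products into [F]. *)
Lemma sum_coprod_counitl (V : nmodType) (F : forest A * forest A -> V) h :
  \sum_(p <- coprod h | p.1 == fone) F p = F (fone, h).
Proof.
rewrite big_mkcond /=.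
elim/forest_ind: h F => [|a h IH|h k IHh IHk] F.
- by rewrite sum_coprod1 eqxx.
- by rewrite sum_coprod_graft /= graft_neq1 add0r (IH (fun p => F (p.1, graft a p.2))).
- rewrite sum_coprodM -(IHk (fun q => F (fone, fmul h q.2))) exchange_big /=.
  apply: eq_bigr => q _; case: ifP => [q1|q1]; last first.
    by rewrite big1 // => p _; rewrite fmul_eq1 q1 andbF.
  under eq_bigr do rewrite fmul_eq1 q1 andbT.
  by rewrite (IHh (fun p => F (fmul p.1 q.1, fmul p.2 q.2))) /= (eqP q1) fmulf1.
Qed.

Lemma sum_coprod_counitr (V : nmodType) (F : forest A * forest A -> V) h :
  \sum_(p <- coprod h | p.2 == fone) F p = F (h, fone).
Proof.
rewrite big_mkcond /=.
elim/forest_ind: h F => [|a h _|h k IHh IHk] F.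
- by rewrite sum_coprod1 eqxx.
- rewrite sum_coprod_graft /= eqxx big1 ?addr0// => p _.
  by rewrite graft_neq1.
- rewrite sum_coprodM -(IHk (fun q => F (fmul h q.1, fone))) exchange_big /=.
  apply: eq_bigr => q _; case: ifP => [q1|q1]; last first.
    by rewrite big1 // => p _; rewrite fmul_eq1 q1 andbF.
  under eq_bigr do rewrite fmul_eq1 q1 andbT.
  by rewrite (IHh (fun p => F (fmul p.1 q.1, fmul p.2 q.2))) /= (eqP q1) fmulf1.
Qed.

(** The two extreme terms are distinct because [h] is not the unit; what remains is the reduced
    coproduct, whose factors are all strictly smaller than [h]. *)
Lemma sum_coprod_reduced (V : nmodType) (F : forest A * forest A -> V) h :
  h != fone -> \sum_(p <- coprod h) F p = F (fone, h) + (F (h, fone) +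
    \sum_(p <- coprod h | (p.1 != fone) && (p.2 != fone)) F p).
Proof.
move=> h1; rewrite (bigID (fun p => p.1 == fone)) /= sum_coprod_counitl.
congr (_ + _); rewrite (bigID (fun p => p.2 == fone)) /=; congr (_ + _).
rewrite -sum_coprod_counitr big_seq_cond [RHS]big_seq_cond; apply: eq_bigl => p.
case: (boolP (p \in _)) => //= /coprod_fsize ph; case: eqVneq => //= p1.
by case: eqVneq => //= p2; move: h1; rewrite -fsize_eq0 -ph p1 p2 fsize1.
Qed.

(** Coassociativity, phrased through sums because the list [coprod h] is meaningful only up to
    permutation. For a product the sums over the two factors separate, and the induction hypotheses
    apply one after the other. *)
Lemma coprod_coassoc (V : nmodType) (F : forest A -> forest A -> forest A -> V) h :
  \sum_(p <- coprod h) \sum_(q <- coprod p.1) F q.1 q.2 p.2 =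
  \sum_(p <- coprod h) \sum_(q <- coprod p.2) F p.1 q.1 q.2.
Proof.
elim/forest_ind: h F => [|a h IH|h k IHh IHk] F.
- by rewrite !sum_coprod1 /= ?sum_coprod1.
- rewrite !sum_coprod_graft /= ?sum_coprod_graft ?sum_coprod1 /= -addrA.
  rewrite (IH (fun x y z => F x y (graft a z))) -big_split /=; congr (_ + _).
  by apply: eq_bigr => p _; rewrite sum_coprod_graft.
- transitivity (\sum_(p <- coprod h) \sum_(q <- coprod p.1)
      \sum_(p' <- coprod k) \sum_(q' <- coprod p'.1)
        F (fmul q.1 q'.1) (fmul q.2 q'.2) (fmul p.2 p'.2)).
    rewrite sum_coprodM; apply: eq_bigr => p _; rewrite [RHS]exchange_big /=.
    by apply: eq_bigr => p' _; rewrite sum_coprodM.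
  transitivity (\sum_(p <- coprod h) \sum_(q <- coprod p.1)
      \sum_(p' <- coprod k) \sum_(q' <- coprod p'.2)
        F (fmul q.1 p'.1) (fmul q.2 q'.1) (fmul p.2 q'.2)).
    apply: eq_bigr => p _; apply: eq_bigr => q _.
    exact: (IHk (fun x y z => F (fmul q.1 x) (fmul q.2 y) (fmul p.2 z))).
  rewrite sum_coprodM.
  rewrite (IHh (fun x y z => \sum_(p' <- coprod k) \sum_(q' <- coprod p'.2)
     F (fmul x p'.1) (fmul y q'.1) (fmul z q'.2))).
  apply: eq_bigr => p _; rewrite exchange_big /=.
  by apply: eq_bigr => p' _; rewrite sum_coprodM.
Qed.

End Forests.

(** A nonempty planar forest of size at most n+1 is a root label with two planar forests of size at
    most n: the branches at the first root and the other trees. *)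
Lemma finite_forests_le (A : finType) n : finite_set (@forests_le A n).
Proof.
suff fin : finite_set [set f : seq (ptree A) | (pfsize f <= n)%N].
  apply: sub_finite_set (finite_image (fun f => \pi_(forest A) f) fin).
  by elim/forestW => f; rewrite /forests_le /= fsize_pi => fn; exists f.
elim: n => [|n IH].
  apply: sub_finite_set (finite_set1 [::]) => -[|[a g] f] //=.
pose c := fun (x : A * seq (ptree A)) g => PNode x.1 x.2 :: g.
have fA : finite_set [set: A] by exact: finite_finset.
have fc := finite_image2 c (finite_setX fA IH) IH.
have : finite_set ([set [::]] `|` [set c x g | x in [set: A] `*`
    [set f | (pfsize f <= n)%N] & g in [set f | (pfsize f <= n)%N]]).
  by rewrite finite_setU; split; first exact: finite_set1.
apply: sub_finite_set => -[|[a g] f] /=; first by left.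
rewrite /pfsize /= => le; right; exists (a, g) => /=; first by split; rewrite /pfsize; lia.
by exists f => //=; rewrite /pfsize; lia.
Qed.

Definition forest_seq (A : finType) n : seq (forest A) :=
  enum_fset (fset_set (@forests_le A n)).

Lemma mem_forest_seq (A : finType) n (h : forest A) :
  (h \in forest_seq A n) = (fsize h <= n)%N.
Proof.
have := in_fset_set (finite_forests_le A n) h; rewrite /forest_seq => ->.
by apply/asboolP/idP.
Qed.

Lemma forest_seq_uniq (A : finType) n : uniq (forest_seq A n).
Proof. exact: fset_uniq. Qed.

(** * Functionals, transports and Hoelder bounds *)

(** Merges finitely many constants into one; [1 <= K] supplies positivity wherever it is used. *)
Lemma seq_bound (R : realType) (I : eqType) (r : seq I) (P : I -> R -> Prop) :
  (forall i x y, x <= y -> P i x -> P i y) ->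
  (forall i, i \in r -> exists x, P i x) ->
  exists2 K, 1 <= K & forall i, i \in r -> P i K.
Proof.
move=> mono; elim: r => [|i r IH] ex; first by exists 1.
have [K K1 PK] := IH (fun j jr => ex j (mem_behead (s := i :: r) jr)).
have [x Px] := ex i (mem_head _ _).
exists (Num.max K x) => [|j]; first by rewrite le_max K1.
rewrite inE => /orP[/eqP ->|/PK Pj]; first by apply: mono Px; rewrite le_max lexx orbT.
by apply: mono Pj; rewrite le_max lexx.
Qed.

Section Functionals.
Variables (R : realType) (A : finType).
Implicit Types (phi psi chi : functional R A) (h k : forest A) (z : forest A -> R).

Lemma starA phi psi chi : star phi (star psi chi) = star (star phi psi) chi.
Proof.
apply/funext => h; rewrite /star.
transitivity (\sum_(p <- coprod h) \sum_(q <- coprod p.2)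
   phi p.1 * psi q.1 * chi q.2).
  by apply: eq_bigr => p _; rewrite mulr_sumr; apply: eq_bigr => q _; rewrite mulrA.
rewrite -(@coprod_coassoc A _ (fun x y w => phi x * psi y * chi w)).
by apply: eq_bigr => p _; rewrite mulr_suml.
Qed.

Lemma star_dirac phi h k :
  star phi (dirac_forest R h) k = \sum_(p <- coprod k | p.2 == h) phi p.1.
Proof.
rewrite /star [RHS]big_mkcond; apply: eq_bigr => p _; rewrite /dirac_forest.
by case: eqP => _; rewrite ?mulr1 ?mulr0.
Qed.

Lemma star_counitr phi : star phi (dirac_forest R fone) = phi.
Proof.
apply/funext => h; rewrite star_dirac.
exact: (@sum_coprod_counitr A _ (fun p => phi p.1)).
Qed.

Lemma star_counitl phi : star (dirac_forest R fone) phi = phi.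
Proof.
apply/funext => h; rewrite -[RHS](@sum_coprod_counitl A _ (fun p => phi p.2)).
rewrite /star [RHS]big_mkcond; apply: eq_bigr => p _; rewrite /dirac_forest.
by case: eqP => _; rewrite ?mul1r ?mul0r.
Qed.

Lemma star_reduced phi psi h : phi fone = 1 -> psi fone = 1 -> h != fone ->
  star phi psi h = psi h + (phi h +
    \sum_(p <- coprod h | (p.1 != fone) && (p.2 != fone)) phi p.1 * psi p.2).
Proof.
by move=> phi1 psi1 h1; rewrite /star sum_coprod_reduced //= phi1 psi1 mul1r mulr1.
Qed.

Lemma reduced_fsize h p : p \in coprod h -> p.1 != fone -> p.2 != fone ->
  [/\ (0 < fsize p.1)%N, (fsize p.1 < fsize h)%N, (0 < fsize p.2)%N &
      (fsize p.2 < fsize h)%N].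
Proof. by move=> /coprod_fsize; rewrite -!fsize_gt0 => ph p1 p2; split; lia. Qed.

(** Meant for [X s s], which Chen's relation makes idempotent. By induction on the size the reduced
    terms vanish, which leaves phi h = phi h + phi h. *)
Lemma star_idem_counit phi :
  phi fone = 1 -> star phi phi = phi -> phi = dirac_forest R fone.
Proof.
move=> phi1 idem; apply/funext => h; have [n] := ubnP (fsize h).
elim: n h => // n IH h; rewrite ltnS /dirac_forest => hn.
case: eqVneq => [->//|h1].
have := congr1 (@^~ h) idem; rewrite /= star_reduced //.
rewrite big_seq_cond big1 ?addr0 => [|p /and3P[ph p1 p2]].
  by move=> e; apply: (addrI (phi h)); rewrite addr0.
have [_ lt1 _ _] := reduced_fsize ph p1 p2.
by rewrite IH ?(leq_trans lt1)// /dirac_forest (negbTE p1) mul0r.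
Qed.

(** The operator G of the overview, truncated at size [n], with an arbitrary functional [phi] in
    place of X_{st}. *)
Definition transport n phi z h : R := pairing n (star phi (dirac_forest R h)) z.

Lemma transportE n phi z h : transport n phi z h =
  \sum_(k <- forest_seq A n) \sum_(p <- coprod k | p.2 == h) phi p.1 * z k.
Proof.
rewrite /transport /pairing fsbig_finite; last exact: finite_forests_le.
by apply: eq_bigr => k _; rewrite star_dirac mulr_suml.
Qed.

Lemma transportD n phi y z h : transport n phi (fun k => y k + z k) h =
  transport n phi y h + transport n phi z h.
Proof.
rewrite !transportE -big_split /=; apply: eq_bigr => k _.
by rewrite -big_split /=; apply: eq_bigr => p _; rewrite mulrDr.
Qed.

Lemma transportZ n phi c z h :
  transport n phi (fun k => c * z k) h = c * transport n phi z h.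
Proof.
rewrite !transportE mulr_sumr; apply: eq_bigr => k _.
by rewrite mulr_sumr; apply: eq_bigr => p _; rewrite mulrCA.
Qed.

Lemma transportB n phi y z h : transport n phi (fun k => y k - z k) h =
  transport n phi y h - transport n phi z h.
Proof.
rewrite transportD -[in RHS]mulN1r -transportZ; congr (_ + _).
by rewrite !transportE; under [RHS]eq_bigr do under eq_bigr do rewrite mulN1r.
Qed.

Lemma eq_transport n phi y z h : (forall k, (fsize k <= n)%N -> y k = z k) ->
  transport n phi y h = transport n phi z h.
Proof.
move=> yz; rewrite !transportE big_seq [RHS]big_seq.
by apply: eq_bigr => k; rewrite mem_forest_seq => /yz ->.
Qed.

(** Associativity of [star], after expanding over the intermediate forest. The truncation loses
    nothing: the coproduct is graded, so the intermediate forests are no larger than the outer one,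
    hence of size at most [n]. *)
Lemma transport_comp n phi psi z h :
  transport n psi (transport n phi z) h = transport n (star phi psi) z h.
Proof.
have E f y g : transport n f y g =
    \sum_(k <- forest_seq A n) star f (dirac_forest R g) k * y k.
  by rewrite /transport /pairing fsbig_finite //; exact: finite_forests_le.
rewrite !E; under eq_bigr do rewrite E mulr_sumr.
rewrite exchange_big /= big_seq [RHS]big_seq; apply: eq_bigr => l.
rewrite mem_forest_seq => ln; rewrite -starA.
under eq_bigr do rewrite mulrA mulrC; rewrite -mulr_sumr mulrC; congr (_ * _).
set chi := star psi _; rewrite /star.
under eq_bigr do rewrite mulr_sumr; rewrite exchange_big /= big_seq [RHS]big_seq.
apply: eq_bigr => p /coprod_fsize pl; rewrite /dirac_forest.
have p2n : p.2 \in forest_seq A n by rewrite mem_forest_seq; lia.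
rewrite (bigD1_seq p.2 p2n (forest_seq_uniq A n)) /=.
rewrite eqxx mulr1 mulrC big1 ?addr0 // => k kp.
by rewrite eq_sym (negbTE kp) mulr0 mulr0.
Qed.

Lemma transport_counit n z h : (fsize h <= n)%N ->
  transport n (dirac_forest R fone) z h = z h.
Proof.
move=> hn; rewrite /transport star_counitl /pairing fsbig_finite; last first.
  exact: finite_forests_le.
rewrite -/(forest_seq A n) (bigD1_seq h) ?forest_seq_uniq ?mem_forest_seq //=.
rewrite /dirac_forest eqxx mul1r big1 ?addr0 // => k kh.
by rewrite (negbTE kh) mul0r.
Qed.

Lemma transport_out n phi z h : (n < fsize h)%N -> transport n phi z h = 0.
Proof.
move=> hn; rewrite transportE big_seq big1 // => k.
rewrite mem_forest_seq => kn; rewrite big_seq_cond big1 // => p /andP[].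
by move=> /coprod_fsize pk /eqP ph; move: pk; rewrite ph; lia.
Qed.

End Functionals.

(** * Hoelder bounds for functions of two times, and the sewing estimate *)

Section Holder.
Variables (R : realType) (T : {posnum R}).
Implicit Types (F G : time T -> time T -> R) (s t : time T) (C e : R).

Definition dist s t : R := `|val t - val s|.

Lemma distC s t : dist s t = dist t s.
Proof. by rewrite /dist distrC. Qed.

Lemma dist_ge0 s t : 0 <= dist s t.
Proof. exact: normr_ge0. Qed.

Lemma dist_gt0 s t : (0 < dist s t) = (s != t).
Proof. by rewrite normr_gt0 subr_eq0 eq_sym. Qed.

Lemma distxx s : dist s s = 0.
Proof. by rewrite /dist subrr normr0. Qed.

Lemma dist_le s t : dist s t <= T%:num.
Proof.
have /andP[s0 sT] := valP s; have /andP[t0 tT] := valP t.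
by rewrite /dist ler_norml; apply/andP; split; lra.
Qed.

Lemma powR_le_exp (x a b : R) : 0 < x -> x <= T%:num -> a <= b ->
  x `^ b <= T%:num `^ (b - a) * x `^ a.
Proof.
move=> x0 xT ab; have -> : x `^ b = x `^ (b - a) * x `^ a.
  by rewrite -powRD ?subrK //; apply/implyP => _; rewrite gt_eqF.
by rewrite ler_wpM2r ?powR_ge0// ge0_ler_powR ?subr_ge0 ?nnegrE // ltW.
Qed.

Lemma powR_le_base (x y a : R) : 0 <= a -> 0 <= x -> x <= y -> x `^ a <= y `^ a.
Proof.
by move=> a0 x0 xy; apply: ge0_ler_powR; rewrite ?nnegrE // (le_trans x0).
Qed.

Definition hbounded (g C : R) F : Prop :=
  forall s t, s != t -> `|F s t| <= C * dist s t `^ g.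

(** Since T > 0 there are two distinct times, so the supremum is not the one of the empty set. *)
Lemma holder_ge0 g F : (0 <= holder g F)%E.
Proof.
have T0 : (0 : R) <= T%:num <= T%:num by rewrite lexx andbT.
pose t1 : time T := exist (fun t : R => is_true (0 <= t <= T%:num)) _ T0.
apply: (@le_trans _ _ (`|F (time0 T) t1| / `|val t1 - val (time0 T)| `^ g)%:E).
  by rewrite lee_fin divr_ge0 ?powR_ge0.
apply: ereal_sup_ubound; exists (time0 T, t1) => //=.
by rewrite -dist_gt0 /dist /= subr0 normr_gt0.
Qed.

Lemma holder_leP g C F : (holder g F <= C%:E)%E <-> hbounded g C F.
Proof.
split=> [le s t st|le]; last first.
  apply: ge_ereal_sup => _ [[s t] /= st <-]; rewrite lee_fin.
  by rewrite ler_pdivrMr ?powR_gt0 ?le //; move: st; rewrite -dist_gt0.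
rewrite -ler_pdivrMr ?powR_gt0 ?dist_gt0// -lee_fin; apply: le_trans le.
by apply: ereal_sup_ubound; exists (s, t).
Qed.

Lemma hbounded_le g C D F : C <= D -> hbounded g C F -> hbounded g D F.
Proof. by move=> CD FC s t /FC/le_trans; apply; rewrite ler_wpM2r ?powR_ge0. Qed.

Lemma hbounded_ge0 g C F : hbounded g C F -> 0 <= C.
Proof. by move=> /holder_leP; move: (holder_ge0 g F) => /le_trans /[apply]. Qed.

Lemma hbounded_exp g g' C F : g' <= g -> hbounded g C F ->
  hbounded g' (C * T%:num `^ (g - g')) F.
Proof.
move=> gg' FC s t st; apply: (le_trans (FC s t st)); rewrite -mulrA.
by rewrite ler_wpM2l ?(hbounded_ge0 FC)// powR_le_exp ?dist_gt0 ?dist_le.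
Qed.

Lemma hboundedD g C D F G : hbounded g C F -> hbounded g D G ->
  hbounded g (C + D) (fun s t => F s t + G s t).
Proof.
move=> FC GD s t st; apply: (le_trans (ler_normD _ _)).
by rewrite mulrDl lerD ?FC ?GD.
Qed.

Lemma hboundedN g C F : hbounded g C F -> hbounded g C (fun s t => - F s t).
Proof. by move=> FC s t st; rewrite normrN FC. Qed.

Lemma hboundedB g C D F G : hbounded g C F -> hbounded g D G ->
  hbounded g (C + D) (fun s t => F s t - G s t).
Proof. by move=> FC /hboundedN; apply: hboundedD. Qed.

Lemma eq_hbounded g C F G : F =2 G -> hbounded g C F -> hbounded g C G.
Proof. by move=> FG FC s t st; rewrite -FG FC. Qed.

Lemma holder_ltyP g F : (holder g F < +oo)%E <-> exists C, hbounded g C F.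
Proof.
split=> [lt|[C /holder_leP le]]; last exact: le_lt_trans (ltry C).
exists (fine (holder g F)); apply/holder_leP; rewrite fineK //.
by rewrite ge0_fin_numE ?holder_ge0.
Qed.

Lemma holder_fin g F : holder g F != +oo%E -> holder g F \is a fin_num.
Proof. by move=> ne; rewrite ge0_fin_numE ?holder_ge0 ?ltey. Qed.

Lemma holderD g F G :
  (holder g (fun s t => F s t + G s t)%R <= holder g F + holder g G)%E.
Proof.
have [/eqP ->|F_fin] := boolP (holder g F == +oo)%E.
  by rewrite addye ?leey // gt_eqF // (lt_le_trans _ (holder_ge0 _ _)).
have [/eqP ->|G_fin] := boolP (holder g G == +oo)%E.
  by rewrite addey ?leey // gt_eqF // (lt_le_trans _ (holder_ge0 _ _)).
rewrite -(fineK (holder_fin F_fin)) -(fineK (holder_fin G_fin)) -EFinD.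
apply/holder_leP/hboundedD; apply/holder_leP; by rewrite fineK ?holder_fin //.
Qed.

Lemma holderN g F G : (forall s t, F s t = - G s t) -> holder g F = holder g G.
Proof.
move=> FG; rewrite /holder; congr ereal_sup; apply/eq_imagel => p _.
by rewrite FG normrN.
Qed.

Lemma midpoint s t : exists2 u : time T,
  dist s u = 2^-1 * dist s t & dist u t = 2^-1 * dist s t.
Proof.
have u_subproof : 0 <= (val s + val t) / 2 <= T%:num.
  have /andP[s0 sT] := valP s; have /andP[t0 tT] := valP t.
  by apply/andP; split; lra.
have half0 : (0 : R) <= 2^-1 by [].
exists (exist (fun t : R => is_true (0 <= t <= T%:num)) _ u_subproof) => /=; rewrite /dist /=;
  by rewrite -[X in X * `|_|](ger0_norm half0) -normrM; congr `|_|; field.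
Qed.

(* The a priori bound K makes the iteration of the sewing argument a fixed point
   inequality for the optimal constant: M <= 2^(1-theta) M + e. *)
Lemma sewing_bound (theta K e : R) F : 1 < theta -> hbounded theta K F ->
  (forall s t, s != t -> exists u,
    [/\ dist s u = 2^-1 * dist s t, dist u t = 2^-1 * dist s t &
        `|F s t - (F s u + F u t)| <= e * dist s t `^ theta]) ->
  hbounded theta (e / (1 - 2 * 2^-1 `^ theta)) F.
Proof.
move=> th1 FK Fe; set q := 2 * _.
have q1 : q < 1.
  have : (2^-1 : R) `^ theta < 2^-1 `^ 1.
    rewrite /powR gt_eqF // ltr_expR ltr_nM2r // ln_lt0 //.
    by apply/andP; split; lra.
  by rewrite powRr1 // /q; lra.
have q0 : 0 <= q by rewrite mulr_ge0 ?powR_ge0.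
pose M := fine (holder theta F).
have Mfin : holder theta F = M%:E.
  rewrite /M fineK // ge0_fin_numE ?holder_ge0//.
  by apply/holder_ltyP; exists K.
have FM : hbounded theta M F by apply/holder_leP; rewrite Mfin.
have : hbounded theta (q * M + e) F.
  move=> s t st; have [u [su ut le]] := Fe s t st.
  have half v w : dist v w = 2^-1 * dist s t ->
      `|F v w| <= M * (2^-1 `^ theta * dist s t `^ theta).
    move=> vw; rewrite -powRM ?dist_ge0 // -vw; apply: FM.
    by rewrite -dist_gt0 vw mulr_gt0 ?dist_gt0.
  rewrite -[F s t](subrK (F s u + F u t)) addrC mulrDl.
  apply: (le_trans (ler_normD _ _)); apply: lerD => //.
  apply: (le_trans (ler_normD _ _)).
  apply: (le_trans (lerD (half _ _ su) (half _ _ ut))).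
  by rewrite /q le_eqVlt; apply/orP; left; apply/eqP; ring.
move=> /holder_leP; rewrite Mfin lee_fin => Mle.
apply: hbounded_le FM; rewrite ler_pdivlMr ?subr_gt0 //; lra.
Qed.

End Holder.

(** * Branched rough paths *)

(** Excluding inverses of integers makes the second bound strict. The third puts every forest with
    more than [level alpha] nodes within reach of [sewing_bound]. *)
Lemma level_itv (R : realType) (alpha : R) : 0 < alpha < 1 ->
  (forall n : nat, (0 < n)%N -> alpha <> 1 / n%:R) ->
  [/\ (0 < level alpha)%N, (level alpha)%:R * alpha < 1 &
      1 < alpha * (level alpha).+1%:R].
Proof.
move=> /andP[a0 a1] aN; rewrite /level; set x := 1 / alpha.
have x1 : 1 < x by rewrite /x ltr_pdivlMr // mul1r.
have /truncn_itv/andP[le lt] : 0 <= x by lra.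
have N0 : (0 < Num.truncn x)%N by rewrite truncn_gt0 ltW.
split=> //; last by move: lt; rewrite /x ltr_pdivrMr // mulrC.
have := aN _ N0; move: le; rewrite {1}/x ler_pdivlMr // le_eqVlt => /orP[/eqP e|//].
have n0 : (Num.truncn x)%:R != 0 :> R by rewrite pnatr_eq0 -lt0n.
by case; rewrite -[LHS](mulKf n0) e mulr1 div1r.
Qed.

Section RoughPaths.
Variables (R : realType) (A : finType) (T : {posnum R}).
Implicit Types (X Y : process A T) (h k : forest A) (s t u : time T).
Implicit Types (r z : forest A -> R).

Section Character.
Variables (alpha : R) (alpha0 : 0 < alpha).

Lemma branched1 X s t : branched_rough_paths alpha X -> X s t fone = 1.
Proof. by case=> /(_ s t)[]. Qed.

Lemma branched_diag X s : branched_rough_paths alpha X ->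
  X s s = dirac_forest R fone.
Proof. by move=> bX; apply: star_idem_counit; [exact: branched1|case: bX]. Qed.

Lemma branched_bound n X : branched_rough_paths alpha X ->
  exists2 K, 1 <= K & forall h, (fsize h <= n)%N -> forall s t,
    `|X s t h| <= K * dist s t `^ (alpha * (fsize h)%:R).
Proof.
move=> bX; pose P h K := hbounded (alpha * (fsize h)%:R) K (fun s t => X s t h).
have mono h x y : x <= y -> P h x -> P h y by exact: hbounded_le.
have ex h : h \in forest_seq A n -> exists K, P h K.
  by move=> _; apply/holder_ltyP; case: bX.
have [K K1 XK] := seq_bound mono ex.
exists K => // h hn s t; have [<-|st] := eqVneq s t; last first.
  by apply: XK; rewrite ?mem_forest_seq.
rewrite (branched_diag s bX) distxx /dirac_forest.
(* For the unit the exponent is 0 and a power with exponent 0 equals 1, even at distance 0. *)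
case: eqVneq => [->|h1]; first by rewrite fsize1 mulr0 powRr0 mulr1 normr1.
by rewrite normr0 mulr_ge0 ?powR_ge0 // (le_trans ler01).
Qed.

Lemma transport_chen n X s t u z h : branched_rough_paths alpha X ->
  transport n (X u t) (transport n (X s u) z) h = transport n (X s t) z h.
Proof. by move=> [_ chen _]; rewrite transport_comp chen. Qed.

Lemma transport_diag n X s z h : branched_rough_paths alpha X ->
  (fsize h <= n)%N -> transport n (X s s) z h = z h.
Proof. by move=> bX hn; rewrite (branched_diag s bX) transport_counit. Qed.

(* Weighting the component of [h] by [tau^((n+1-|h|) beta)] makes all transports
   over distances at most [tau] uniformly bounded. *)
Lemma transport_bound n X (beta : R) : 0 <= beta <= alpha ->
  branched_rough_paths alpha X ->
  exists2 C, 0 <= C & forall w tau r s t,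
    0 <= w -> 0 < tau -> tau <= T%:num -> dist s t <= tau ->
    (forall k, (fsize k <= n)%N ->
       `|r k| <= w * tau `^ ((n.+1 - fsize k)%N%:R * beta)) ->
    forall h, (fsize h <= n)%N -> `|transport n (X s t) r h| <=
       C * w * tau `^ ((n.+1 - fsize h)%N%:R * beta).
Proof.
move=> /andP[b0 ba] bX; have [K K1 XK] := branched_bound n bX.
pose P (m : nat) B := T%:num `^ ((alpha - beta) * m%:R) <= B.
have mono m x y : x <= y -> P m x -> P m y by move=> xy /le_trans; apply.
have ex m : m \in iota 0 n.+1 -> exists B, P m B by move=> _; eexists; exact: lexx.
have [B B1 TB] := seq_bound mono ex.
have K0 : 0 <= K by lra.
have B0 : 0 <= B by lra.
exists (\sum_(k <- forest_seq A n) \sum_(p <- coprod k) K * B).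
  by apply: sumr_ge0 => k _; apply: sumr_ge0 => p _; rewrite mulr_ge0.
move=> w tau r s t w0 tau0 tauT st rk h hn.
rewrite transportE -mulrA mulr_suml big_seq [X in _ <= X]big_seq.
apply: (le_trans (ler_norm_sum _ _ _)); apply: ler_sum => k.
rewrite mem_forest_seq => kn; apply: (le_trans (ler_norm_sum _ _ _)).
rewrite mulr_suml big_mkcond /= big_seq [X in _ <= X]big_seq; apply: ler_sum => p pk.
have := coprod_fsize pk; case: eqP => [->|_ _]; last first.
  by rewrite !mulr_ge0 ?powR_ge0.
move=> pkh; rewrite normrM.
have p1n : (fsize p.1 <= n)%N by clear - pkh kn; lia.
have p1i : fsize p.1 \in iota 0 n.+1 by rewrite mem_iota; clear - p1n; lia.
have hk : (n.+1 - fsize h = fsize p.1 + (n.+1 - fsize k))%N by clear - pkh kn; lia.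
have le1 : `|X s t p.1| <= K * (B * tau `^ (beta * (fsize p.1)%:R)).
  apply: (le_trans (XK _ p1n s t)); rewrite ler_wpM2l //.
  apply: (@le_trans _ _ (tau `^ (alpha * (fsize p.1)%:R))).
    by rewrite powR_le_base ?dist_ge0// mulr_ge0 ?(ltW alpha0).
  apply: (le_trans (powR_le_exp (T := T) (a := beta * (fsize p.1)%:R) tau0 tauT _)).
    by rewrite ler_wpM2r.
  by rewrite ler_wpM2r ?powR_ge0 // -mulrBl; exact: TB.
have -> : tau `^ ((n.+1 - fsize h)%N%:R * beta) =
    tau `^ (beta * (fsize p.1)%:R) * tau `^ ((n.+1 - fsize k)%N%:R * beta).
  rewrite -powRD; last by apply/implyP => _; rewrite gt_eqF.
  by rewrite (mulrC beta) -mulrDl -natrD hk.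
apply: (le_trans (ler_pM _ _ le1 (rk _ kn))) => //.
by rewrite le_eqVlt; apply/orP; left; apply/eqP; ring.
Qed.

(** By Chen's relation the defect of additivity of the difference involves only reduced terms, hence
    only smaller forests. The Hoelder bounds of the two rough paths at [h] give the a priori bound
    required by [sewing_bound], but do not enter the resulting constant. *)
Lemma level_gap h : 1 < alpha * (fsize h)%:R -> exists2 C, 0 <= C &
  forall X Y K e, branched_rough_paths alpha X -> branched_rough_paths alpha Y ->
  0 <= K -> 0 <= e ->
  (forall k, (0 < fsize k)%N -> (fsize k < fsize h)%N ->
   [/\ hbounded (alpha * (fsize k)%:R) K (fun s t => X s t k),
       hbounded (alpha * (fsize k)%:R) K (fun s t => Y s t k) &
       hbounded (alpha * (fsize k)%:R) e (fun s t => X s t k - Y s t k)]) ->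
  hbounded (alpha * (fsize h)%:R) (C * K * e) (fun s t => X s t h - Y s t h).
Proof.
set theta := alpha * _ => th1.
have h1 : h != fone.
  by rewrite -fsize_eq0; apply/eqP => h0; move: th1; rewrite /theta h0 mulr0; lra.
(* Each pair of the coproduct contributes at most 2 K e to the defect; the denominator is that of
   [sewing_bound]. The absolute value taken next spares a discussion of its sign. *)
pose c := 2 * (size (coprod h))%:R / (1 - 2 * 2^-1 `^ theta) : R.
exists `|c| => // X Y K e bX bY K0 e0 low.
have [_ chX /(_ h)/holder_ltyP[a Xa]] := bX.
have [_ chY /(_ h)/holder_ltyP[b Yb]] := bY.
pose E := \sum_(p <- coprod h) (2 * K * e).
apply: (@hbounded_le _ _ _ (E / (1 - 2 * 2^-1 `^ theta))).
  have -> : E = 2 * (size (coprod h))%:R * K * e.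
    by rewrite /E big_const_seq count_predT iter_addr_0 -mulr_natr; ring.
  rewrite (_ : _ / _ = c * (K * e)); last by rewrite /c; ring.
  by rewrite -mulrA ler_wpM2r ?mulr_ge0 // ler_norm.
apply: (sewing_bound th1 (hboundedB Xa Yb)) => s t st.
have [u su ut] := midpoint s t; exists u; split=> //.
have lt u' v : dist u' v = 2^-1 * dist s t -> u' != v /\ dist u' v <= dist s t.
  move=> e'; rewrite -dist_gt0 e'; have := dist_gt0 s t; rewrite st => d0.
  by split; lra.
have [nsu lsu] := lt _ _ su; have [nut lut] := lt _ _ ut.
rewrite -(chX s u t) -(chY s u t) !star_reduced ?(branched1 _ _ bX) ?(branched1 _ _ bY) //.
set SX := \sum_(p <- _ | _) _; set SY := \sum_(p <- _ | _) _.
rewrite (_ : _ - _ = SX - SY); last by rewrite /SX /SY; ring.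
rewrite /SX /SY -sumrB /E mulr_suml big_mkcond /= big_seq [X in _ <= X]big_seq.
apply: (le_trans (ler_norm_sum _ _ _)); apply: ler_sum => p ph.
case: ifP => [/andP[p1 p2]|_]; last by rewrite normr0 !mulr_ge0 ?powR_ge0.
have [g1 l1 g2 l2] := reduced_fsize ph p1 p2.
have [X1 Y1 D1] := low _ g1 l1; have [X2 Y2 D2] := low _ g2 l2.
(* The difference of products is telescoped, so that each summand carries one factor bounded by [K]
   and one by [e]. *)
rewrite (_ : _ - _ = X s u p.1 * (X u t p.2 - Y u t p.2) +
    (X s u p.1 - Y s u p.1) * Y u t p.2); last by ring.
have -> : dist s t `^ theta =
    dist s t `^ (alpha * (fsize p.1)%:R) * dist s t `^ (alpha * (fsize p.2)%:R).
  rewrite -powRD; last by apply/implyP => _; rewrite gt_eqF ?dist_gt0.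
  by rewrite -mulrDr -natrD (coprod_fsize ph).
apply: (le_trans (ler_normD _ _)); rewrite !normrM.
have up (F : time T -> time T -> R) C (k : forest A) v w : v != w -> dist v w <= dist s t ->
    hbounded (alpha * (fsize k)%:R) C F ->
    `|F v w| <= C * dist s t `^ (alpha * (fsize k)%:R).
  move=> vw le FC; apply: (le_trans (FC _ _ vw)); rewrite ler_wpM2l ?(hbounded_ge0 FC)//.
  by rewrite powR_le_base ?dist_ge0 // mulr_ge0 // ltW.
have := ler_pM (normr_ge0 _) (normr_ge0 _) (up _ _ _ _ _ nsu lsu X1) (up _ _ _ _ _ nut lut D2).
have := ler_pM (normr_ge0 _) (normr_ge0 _) (up _ _ _ _ _ nsu lsu D1) (up _ _ _ _ _ nut lut Y2).
set a1 := dist s t `^ _; set a2 := dist s t `^ _ => le1 le2.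
apply: (le_trans (lerD le2 le1)).
by rewrite le_eqVlt; apply/orP; left; apply/eqP; ring.
Qed.

End Character.
End RoughPaths.

(** * The flat distance *)

Section FlatDistance.
Variables (R : realType) (A : finType) (T : {posnum R}) (alpha : R).
Implicit Types (X Y : process A T) (Z W : hpath A T) (h : forest A).
Implicit Types (x y : process A T * hpath A T) (g e : R).

Let N := level alpha.

Lemma remainderE X Z h s t :
  remainder alpha X Z h s t = Z t h - transport N.-1 (X s t) (Z s) h.
Proof. by []. Qed.

Lemma remainderB X Z W h s t :
  remainder alpha X (fun t h => Z t h - W t h) h s t =
  remainder alpha X Z h s t - remainder alpha X W h s t.
Proof. by rewrite !remainderE transportB; ring. Qed.

(** A componentwise, real-valued substitute for the flat distance, equivalent to it up to the factor
    [flat_const]. *)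
Definition close g e x y : Prop :=
  [/\ forall h, h != fone -> (fsize h <= N)%N ->
        hbounded ((fsize h)%:R * alpha) e (fun s t => x.1 s t h - y.1 s t h),
      forall h, (fsize h <= N.-1)%N -> `|x.2 (time0 T) h - y.2 (time0 T) h| <= e
    & forall h, (fsize h <= N.-1)%N -> hbounded ((N - fsize h)%N%:R * g) e
        (fun s t => remainder alpha x.1 x.2 h s t - remainder alpha y.1 y.2 h s t)].

Lemma rho_leP X Y e : (rho alpha X Y <= e%:E)%E <->
  (forall h, h != fone -> (fsize h <= N)%N ->
     hbounded ((fsize h)%:R * alpha) e (fun s t => X s t h - Y s t h)).
Proof.
split=> [le h h1 hN|le].
  apply/holder_leP; apply: le_trans le; apply: ereal_sup_ubound.
  by exists h => //; split=> // /eqP; rewrite (negbTE h1).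
apply: ge_ereal_sup => _ [h [hN /eqP h1] <-]; exact/holder_leP/le.
Qed.

(** A single node witnesses that the supremum defining [rho] ranges over a nonempty set. *)
Lemma rho_ge0 X Y : (0 < #|A|)%N -> (0 < N)%N -> (0 <= rho alpha X Y)%E.
Proof.
move=> /card_gt0P[a _] N0; apply: (le_trans (holder_ge0 ((fsize (graft a fone))%:R * alpha)
   (fun s t => X s t (graft a fone) - Y s t (graft a fone)))).
apply: ereal_sup_ubound; exists (graft a fone) => //; split.
  by rewrite /forests_le /= fsize_graft fsize1.
by move=> /eqP; rewrite graft_neq1.
Qed.

Lemma rhoC X Y : rho alpha X Y = rho alpha Y X.
Proof.
rewrite /rho; congr ereal_sup; apply/eq_imagel => h _.
by apply: holderN => s t; rewrite opprB.
Qed.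

Lemma rho_triangle Y X X' : (rho alpha X X' <= rho alpha X Y + rho alpha Y X')%E.
Proof.
apply: ge_ereal_sup => _ [h hN <-].
have -> : (fun s t => X s t h - X' s t h) =
    (fun s t => (X s t h - Y s t h) + (Y s t h - X' s t h)).
  by apply/funext => s; apply/funext => t; rewrite addrA subrK.
by apply: (le_trans (holderD _ _ _)); apply: leeD; apply: ereal_sup_ubound; exists h.
Qed.

Lemma cdistE g X Y Z W : cdist alpha g X Y Z W =
  (\sum_(h <- forest_seq A N.-1) (`|Z (time0 T) h - W (time0 T) h|%R%:E +
     holder ((N - fsize h)%N%:R * g)%R
       (fun s t => remainder alpha X Z h s t - remainder alpha Y W h s t)%R))%E.
Proof. by rewrite /cdist fsbig_finite //; exact: finite_forests_le. Qed.

Lemma cnormE g X Z : cnorm alpha g X Z =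
  (\sum_(h <- forest_seq A N.-1) (`|Z (time0 T) h|%:E +
     holder ((N - fsize h)%N%:R * g)%R (remainder alpha X Z h)))%E.
Proof. by rewrite /cnorm fsbig_finite //; exact: finite_forests_le. Qed.

Lemma cdist_ge0 g X Y Z W : (0 <= cdist alpha g X Y Z W)%E.
Proof.
by rewrite cdistE; apply: sume_ge0 => h _; rewrite adde_ge0 ?holder_ge0 ?lee_fin.
Qed.

Lemma cdistC g X Y Z W : cdist alpha g X Y Z W = cdist alpha g Y X W Z.
Proof.
rewrite !cdistE; apply: eq_bigr => h _; rewrite distrC; congr (_ + _)%E.
by apply: holderN => s t; rewrite [RHS]opprB.
Qed.

Lemma cdist_triangle g Y W X Z X' Z' : (cdist alpha g X X' Z Z' <=
  cdist alpha g X Y Z W + cdist alpha g Y X' W Z')%E.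
Proof.
rewrite !cdistE -big_split /=; apply: lee_sum => h _.
rewrite addeACA; apply: leeD.
  by rewrite -EFinD lee_fin; apply: ler_distD.
set F := fun s t => remainder alpha X Z h s t - remainder alpha Y W h s t.
set G := fun s t => remainder alpha Y W h s t - remainder alpha X' Z' h s t.
apply: le_trans (holderD _ F G); rewrite le_eqVlt; apply/orP; left; apply/eqP.
by congr holder; apply/funext => s; apply/funext => t; rewrite /F /G addrA subrK.
Qed.

Lemma cnorm_cdist g X Z W :
  cnorm alpha g X (fun t h => Z t h - W t h) = cdist alpha g X X Z W.
Proof.
rewrite cdistE cnormE; apply: eq_bigr => h _; congr (_ + holder _ _)%E.
by apply/funext => s; apply/funext => t; exact: remainderB.
Qed.

Lemma cnorm_ltyP g X Z : (cnorm alpha g X Z < +oo)%E <->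
  exists C, forall h, (fsize h <= N.-1)%N ->
    hbounded ((N - fsize h)%N%:R * g) C (remainder alpha X Z h).
Proof.
rewrite cnormE; split=> [lt|[C hC]].
  pose P h K := hbounded ((N - fsize h)%N%:R * g) K (remainder alpha X Z h).
  have mono h a b : a <= b -> P h a -> P h b by exact: hbounded_le.
  have ex h : h \in forest_seq A N.-1 -> exists K, P h K.
    move=> hN; apply/holder_ltyP; apply: le_lt_trans lt.
    rewrite (bigD1_seq h) ?forest_seq_uniq //=; apply: le_trans (leeDl _ _).
      by rewrite leeDr // lee_fin.
    by apply: sume_ge0 => k _; rewrite adde_ge0 ?holder_ge0 ?lee_fin.
  have [K _ hK] := seq_bound mono ex.
  by exists K => h hN; apply: hK; rewrite mem_forest_seq.
rewrite big_seq; apply: (@lte_sum_pinfty _ _ (forest_seq A N.-1)) => h.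
rewrite mem_forest_seq => /hC/holder_leP le.
by rewrite lte_add_pinfty ?ltry // (le_lt_trans le) ?ltry.
Qed.

Lemma cnorm_lty g X Z : (forall h, (fsize h <= N.-1)%N -> exists C,
    hbounded ((N - fsize h)%N%:R * g) C (remainder alpha X Z h)) ->
  (cnorm alpha g X Z < +oo)%E.
Proof.
move=> ex; pose P h K := hbounded ((N - fsize h)%N%:R * g) K (remainder alpha X Z h).
have mono h a b : a <= b -> P h a -> P h b by exact: hbounded_le.
have ex' h : h \in forest_seq A N.-1 -> exists K, P h K.
  by rewrite mem_forest_seq; exact: ex.
have [K _ hK] := seq_bound mono ex'.
by apply/cnorm_ltyP; exists K => h hN; apply: hK; rewrite mem_forest_seq.
Qed.

Lemma cdist_lt_close g e X Y Z W : (cdist alpha g X Y Z W < e%:E)%E ->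
  (forall h, (fsize h <= N.-1)%N -> `|Z (time0 T) h - W (time0 T) h| <= e) /\
  (forall h, (fsize h <= N.-1)%N -> hbounded ((N - fsize h)%N%:R * g) e
     (fun s t => remainder alpha X Z h s t - remainder alpha Y W h s t)).
Proof.
rewrite cdistE => lt; have bnd h : (fsize h <= N.-1)%N ->
    (`|Z (time0 T) h - W (time0 T) h|%R%:E +
     holder ((N - fsize h)%N%:R * g)%R
       (fun s t => remainder alpha X Z h s t - remainder alpha Y W h s t)%R <= e%:E)%E.
  move=> hN; apply: le_trans (ltW lt).
  rewrite (bigD1_seq h) ?forest_seq_uniq ?mem_forest_seq //=; apply: leeDl.
  by apply: sume_ge0 => k _; rewrite adde_ge0 ?holder_ge0 ?lee_fin.
split=> h /bnd le.
  by rewrite -lee_fin; apply: le_trans le; rewrite leeDl ?holder_ge0.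
by apply/holder_leP; apply: le_trans le; rewrite leeDr ?lee_fin.
Qed.

Lemma close_cdist_le g e X Y Z W :
  (forall h, (fsize h <= N.-1)%N -> `|Z (time0 T) h - W (time0 T) h| <= e) ->
  (forall h, (fsize h <= N.-1)%N -> hbounded ((N - fsize h)%N%:R * g) e
     (fun s t => remainder alpha X Z h s t - remainder alpha Y W h s t)) ->
  (cdist alpha g X Y Z W <= (e * (2 * size (forest_seq A N.-1))%:R)%:E)%E.
Proof.
move=> Z0 RZ; rewrite cdistE.
apply: (@le_trans _ _ (\sum_(h <- forest_seq A N.-1) (2 * e)%:E)%E).
  rewrite big_seq [X in (_ <= X)%E]big_seq; apply: lee_sum => h.
  rewrite mem_forest_seq => hN; rewrite mulrDl mul1r EFinD; apply: leeD.
    by rewrite lee_fin Z0.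
  exact/holder_leP/RZ.
rewrite sumEFin lee_fin big_const_seq count_predT iter_addr_0 -mulr_natr natrM.
by rewrite le_eqVlt; apply/orP; left; apply/eqP; ring.
Qed.

Lemma flat_dist_lt_close g e x y : (0 < #|A|)%N -> (0 < N)%N ->
  (flat_dist alpha g x y < e%:E)%E -> close g e x y.
Proof.
move=> A0 N0 lt; have [] := @cdist_lt_close g e x.1 y.1 x.2 y.2.
  by apply: le_lt_trans lt; rewrite leeDr ?rho_ge0.
move=> Z0 RZ; split=> //; apply/rho_leP; apply: le_trans (ltW lt).
by rewrite leeDl ?cdist_ge0.
Qed.

(** One unit for [rho], and two for each forest in [cdist]: its initial value and its remainder. *)
Definition flat_const : R := (1 + 2 * size (forest_seq A N.-1))%N%:R.

Lemma flat_const_gt0 : 0 < flat_const.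
Proof. by rewrite ltr0n. Qed.

Lemma close_flat_dist_le g e x y : close g e x y ->
  (flat_dist alpha g x y <= (e * flat_const)%:E)%E.
Proof.
case=> X1 Z0 RZ; rewrite /flat_const natrD mulrDr mulr1 EFinD; apply: leeD.
  exact/rho_leP.
exact: close_cdist_le.
Qed.

End FlatDistance.

(** * Limits of Cauchy sequences *)

Lemma seq_eventually (I : eqType) (r : seq I) (P : I -> nat -> Prop) :
  (forall i, i \in r -> exists n0, forall n, (n0 <= n)%N -> P i n) ->
  exists n0, forall n, (n0 <= n)%N -> forall i, i \in r -> P i n.
Proof.
elim: r => [|i r IH] ex; first by exists 0%N.
have [n0 P0] := IH (fun j jr => ex j (mem_behead (s := i :: r) jr)).
have [n1 P1] := ex i (mem_head _ _).
exists (maxn n0 n1) => n; rewrite geq_max => /andP[n0n n1n] j.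
by rewrite inE => /orP[/eqP ->|/P0]; [exact: P1 | exact].
Qed.

Section Limits.
Variable R : realType.
Implicit Types (u v : nat -> R) (l a b e : R).

Lemma cauchy_cvgn u :
  (forall e, 0 < e -> exists n0, forall m n, (n0 <= m)%N -> (n0 <= n)%N ->
     `|u m - u n| <= e) -> u n @[n --> \oo] --> limn u.
Proof.
move=> cau; apply/cauchy_cvgP/cauchy_ballP => e e0.
have [n0 le] := cau (e / 2) (divr_gt0 e0 (ltr0n _ 2)).
pose B := u @` [set n | (n0 <= n)%N].
exists (B, B) => /=; first by split; exists n0 => // n n0n; exists n.
move=> [_ _] /= [[m n0m <-] [n n0n <-]]; rewrite /ball /=.
by apply: le_lt_trans (le _ _ n0m n0n) _; lra.
Qed.

Lemma eq_cvgn u v l : u =1 v -> v n @[n --> \oo] --> l -> u n @[n --> \oo] --> l.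
Proof. by move=> /funext ->. Qed.

Lemma cvgn_dist_le u l a b n0 : u n @[n --> \oo] --> l ->
  (forall n, (n0 <= n)%N -> `|a - u n| <= b) -> `|a - l| <= b.
Proof.
move=> ul le; have cv : `|a - u n| @[n --> \oo] --> `|a - l|.
  by apply: cvg_norm; apply: cvgB => //; exact: cvg_cst.
by apply: (cvgr_to_le cv); exists n0.
Qed.

Lemma cvgn_sum (I : Type) (r : seq I) (P : pred I) (f : I -> nat -> R) (l : I -> R) :
  (forall i, f i n @[n --> \oo] --> l i) ->
  \sum_(i <- r | P i) f i n @[n --> \oo] --> \sum_(i <- r | P i) l i.
Proof. by move=> fl; apply: cvg_big => // -[x y]; exact: add_continuous. Qed.

Lemma cvgn_transport (A : finType) m (phi_ : nat -> functional R A) phi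
    (z_ : nat -> forest A -> R) z h :
  (forall k, phi_ n k @[n --> \oo] --> phi k) ->
  (forall k, z_ n k @[n --> \oo] --> z k) ->
  transport m (phi_ n) (z_ n) h @[n --> \oo] --> transport m phi z h.
Proof.
move=> cphi cz; rewrite transportE; apply: eq_cvgn (fun n => transportE _ _ _ _) _.
by apply: cvgn_sum => k; apply: cvgn_sum => p; apply: cvgM.
Qed.

(** One threshold serves all exponents above [c]: for x at most 1 the exponent [c] is the worst, and
    the other term of the minimum solves x^c = eta. *)
Lemma powR_small (c eta : R) : 0 < c -> 0 < eta -> exists2 d : R, 0 < d &
  forall x a, 0 < x -> x <= d -> c <= a -> x `^ a <= eta.
Proof.
move=> c0 eta0; exists (Num.min 1 (eta `^ c^-1)).
  by rewrite lt_min ltr01 powR_gt0.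
move=> x a x0; rewrite le_min => /andP[x1 xe] ca.
apply: (@le_trans _ _ (x `^ c)); first by rewrite ger_powR ?x0.
apply: (@le_trans _ _ ((eta `^ c^-1) `^ c)).
  by apply: powR_le_base => //; exact: ltW.
by rewrite -powRrM mulVf ?gt_eqF // powRr1 // ltW.
Qed.

End Limits.

(** * Limits of rough paths and of controlled paths, and the little-o condition *)

Section Completeness.
Variables (R : realType) (A : finType) (T : {posnum R}) (alpha : R).
Hypothesis alpha0 : 0 < alpha.
Let N := level alpha.
Hypothesis levelN : 1 < alpha * N.+1%:R.
Implicit Types (X Y : process A T) (Z W : hpath A T) (h : forest A) (e : R).

Section RoughPathLimit.
Variable X_ : nat -> process A T.
Hypothesis branchedX : forall n, branched_rough_paths alpha (X_ n).
Hypothesis cauchyX : forall e, 0 < e -> exists n0, forall m n,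
  (n0 <= m)%N -> (n0 <= n)%N -> forall h, h != fone -> (fsize h <= N)%N ->
  hbounded ((fsize h)%:R * alpha) e (fun s t => X_ m s t h - X_ n s t h).

(** Strong induction on the size. Up to level [N] this is the hypothesis; beyond it [level_gap]
    carries the property over from the smaller forests. *)
Lemma cauchy_all_levels h e : 0 < e -> exists n0, forall n, (n0 <= n)%N ->
  forall m, (n0 <= m)%N ->
  hbounded (alpha * (fsize h)%:R) e (fun s t => X_ m s t h - X_ n s t h).
Proof.
have [b] := ubnP (fsize h); elim: b h e => // b IH h e; rewrite ltnS => hb e0.
have [->|h1] := eqVneq h fone.
  exists 0%N => n _ m _ s t st; rewrite !(branched1 _ _ (branchedX _)) subrr normr0.
  by rewrite mulr_ge0 ?powR_ge0 // ltW.
have [hN|hN] := leqP (fsize h) N.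
  have [n0 le] := cauchyX e0; exists n0 => n n0n m n0m.
  by rewrite mulrC; exact: le.
have lowE (k : forest A) : (k \in forest_seq A (fsize h).-1) = (fsize k < fsize h)%N.
  by rewrite mem_forest_seq -ltnS prednK // fsize_gt0.
have th1 : 1 < alpha * (fsize h)%:R.
  by apply: (lt_le_trans levelN); rewrite ler_pM2l // ler_nat.
have [C C0 gap] := level_gap (A := A) T alpha0 th1.
have low e' : 0 < e' -> exists n0, forall n, (n0 <= n)%N ->
    forall k, k \in forest_seq A (fsize h).-1 -> forall m, (n0 <= m)%N ->
    hbounded (alpha * (fsize k)%:R) e' (fun s t => X_ m s t k - X_ n s t k).
  move=> e'0; pose P (k : forest A) n0 := forall n m, (n0 <= n)%N -> (n0 <= m)%N ->
    hbounded (alpha * (fsize k)%:R) e' (fun s t => X_ m s t k - X_ n s t k).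
  have [k|n0 Pn0] := @seq_eventually _ (forest_seq A (fsize h).-1) P.
    rewrite lowE => kh; have kb := leq_trans kh hb.
    have [n0 le] := IH k e' kb e'0; exists n0 => n n0n m m' nm nm'.
    by apply: le; rewrite (leq_trans n0n).
  by exists n0 => n n0n k kr m n0m; apply: (Pn0 n0 (leqnn _) k kr).
(* From index [n1] on, all terms are within 1 of the [n1]-th at the lower levels, so its bound [K0]
   plus 1 serves them all. *)
have [n1 le1] := low 1 ltr01.
have [K0 K01 bnd] := branched_bound (fsize h) (branchedX n1).
pose K := K0 + 1.
have K_gt0 : 0 < K by rewrite /K; lra.
have XK m k : (n1 <= m)%N -> (0 < fsize k)%N -> (fsize k < fsize h)%N ->
    hbounded (alpha * (fsize k)%:R) K (fun s t => X_ m s t k).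
  move=> n1m k0 kh; have kr : k \in forest_seq A (fsize h).-1 by rewrite lowE.
  have b1 : hbounded (alpha * (fsize k)%:R) K0 (fun s t => X_ n1 s t k).
    by move=> s t _; apply: bnd; exact: ltnW.
  apply: eq_hbounded (hboundedD b1 (le1 _ (leqnn _) k kr m n1m)) => s t.
  by rewrite addrC subrK.
(* Makes C K e' at most [e]; the summand 1 keeps the denominator positive when [C] is 0. *)
pose e' := e / (C * K + 1).
have CK : 0 < C * K + 1 by rewrite ltr_wpDl // mulr_ge0 // ltW.
have e'0 : 0 < e' by rewrite divr_gt0.
have [n2 le2] := low e' e'0.
exists (maxn n1 n2) => n; rewrite geq_max => /andP[n1n n2n] m.
rewrite geq_max => /andP[n1m n2m].
apply: (@hbounded_le _ _ _ (C * K * e')).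
  by rewrite /e' mulrA ler_pdivrMr // mulrC ler_pM2l // lerDl.
apply: gap => //; [exact: ltW | exact: ltW |move=> k k0 kh; split; [exact: XK|exact: XK|]].
by apply: le2 => //; rewrite lowE.
Qed.

Definition rough_limit : process A T := fun s t h => limn (fun n => X_ n s t h).

Lemma cvg_rough_limit s t h : X_ n s t h @[n --> \oo] --> rough_limit s t h.
Proof.
apply: cauchy_cvgn => e e0; have [<-|st] := eqVneq s t.
  exists 0%N => m n _ _; rewrite !(branched_diag s (branchedX _)) subrr normr0.
  exact: ltW.
have d0 : 0 < dist s t `^ (alpha * (fsize h)%:R) by rewrite powR_gt0 ?dist_gt0.
have [n0 le] := cauchy_all_levels h (divr_gt0 e0 d0).
exists n0 => m n n0m n0n; apply: (le_trans (le n n0n m n0m _ _ st)).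
by rewrite divfK // gt_eqF.
Qed.

Lemma rough_limit_close h e : 0 < e -> exists n0, forall n, (n0 <= n)%N ->
  hbounded (alpha * (fsize h)%:R) e (fun s t => X_ n s t h - rough_limit s t h).
Proof.
move=> e0; have [n0 le] := cauchy_all_levels h e0; exists n0 => n n0n s t st.
apply: (cvgn_dist_le (n0 := n0) (@cvg_rough_limit s t h)) => m n0m.
exact: (le m n0m n n0n).
Qed.

(** The algebraic identities involve finite sums and pass to pointwise limits; the Hoelder bounds
    come from a single term of the sequence within 1 of the limit. *)
Lemma rough_limit_branched : branched_rough_paths alpha rough_limit.
Proof.
have uniq (u : nat -> R) (a b : R) : u n @[n --> \oo] --> a ->
    u n @[n --> \oo] --> b -> a = b by exact: cvg_unique.
split.
- move=> s t; split.
    apply: (uniq (fun n => X_ n s t fone)); first exact: cvg_rough_limit.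
    apply: (eq_cvgn (v := cst 1)); last exact: cvg_cst.
    by move=> n; rewrite (branched1 _ _ (branchedX _)).
  move=> h k; apply: (uniq (fun n => X_ n s t (fmul h k))); first exact: cvg_rough_limit.
  have E n : X_ n s t (fmul h k) = X_ n s t h * X_ n s t k.
    by have [/(_ s t)[_ ->]] := branchedX n.
  by apply: (eq_cvgn E); apply: cvgM; exact: cvg_rough_limit.
- move=> s u t; apply/funext => h.
  apply: (uniq (fun n => X_ n s t h)); last exact: cvg_rough_limit.
  have E n : X_ n s t h = star (X_ n s u) (X_ n u t) h.
    by have [_ -> _] := branchedX n.
  by apply: (eq_cvgn E); apply: cvgn_sum => p; apply: cvgM; exact: cvg_rough_limit.
- move=> h; apply/holder_ltyP.
  have [n0 /(_ n0 (leqnn _)) le] := rough_limit_close h ltr01.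
  have [_ _ /(_ h)/holder_ltyP[C XC]] := branchedX n0.
  exists (C + 1); apply: eq_hbounded (hboundedB XC le) => s t.
  by rewrite opprB addrC subrK.
Qed.

Lemma rough_limit_rho e : 0 < e -> exists n0, forall n, (n0 <= n)%N ->
  forall h, h != fone -> (fsize h <= N)%N ->
  hbounded ((fsize h)%:R * alpha) e (fun s t => X_ n s t h - rough_limit s t h).
Proof.
move=> e0; have [n0 le] := cauchyX e0; exists n0 => n n0n h h1 hN s t st.
apply: (cvgn_dist_le (n0 := n0) (@cvg_rough_limit s t h)) => m n0m.
exact: (le n m n0n n0m).
Qed.

Section ControlledLimit.
Variables (g : R) (Z_ : nat -> hpath A T).
Hypothesis spanZ : forall n, path_in_span N.-1 (Z_ n).
Hypothesis cauchyZ0 : forall e, 0 < e -> exists n0, forall m n,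
  (n0 <= m)%N -> (n0 <= n)%N -> forall h, (fsize h <= N.-1)%N ->
  `|Z_ m (time0 T) h - Z_ n (time0 T) h| <= e.
Hypothesis cauchyRZ : forall e, 0 < e -> exists n0, forall m n,
  (n0 <= m)%N -> (n0 <= n)%N -> forall h, (fsize h <= N.-1)%N ->
  hbounded ((N - fsize h)%N%:R * g) e (fun s t =>
    remainder alpha (X_ m) (Z_ m) h s t - remainder alpha (X_ n) (Z_ n) h s t).

Definition controlled_limit : hpath A T := fun t h => limn (fun n => Z_ n t h).

(** Only initial values and remainders are known to be Cauchy. The value at [t] is recovered as the
    remainder from time 0 plus the transported initial value. *)
Lemma cvg_controlled_limit t h : Z_ n t h @[n --> \oo] --> controlled_limit t h.
Proof.
rewrite /controlled_limit; have [hN|hN] := leqP (fsize h) N.-1; last first.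
  have E n : Z_ n t h = 0 by apply: spanZ; rewrite /forests_le /= leqNgt hN.
  rewrite (_ : (fun n => Z_ n t h) = cst 0); last exact/funext.
  by rewrite lim_cst //; exact: cvg_cst.
have c0 k : Z_ n (time0 T) k @[n --> \oo] --> limn (fun n => Z_ n (time0 T) k).
  apply: cauchy_cvgn => e e0; have [kN|kN] := leqP (fsize k) N.-1; last first.
    exists 0%N => m n _ _; rewrite !spanZ ?subrr ?normr0 ?(ltW e0) //;
    by rewrite /forests_le /= leqNgt kN.
  by have [n0 le] := cauchyZ0 e0; exists n0 => m n n0m n0n; exact: le.
have [<-|t0] := eqVneq (time0 T) t; first exact: c0.
pose r n := remainder alpha (X_ n) (Z_ n) h (time0 T) t.
have cr : r n @[n --> \oo] --> limn r.
  apply: cauchy_cvgn => e e0.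
  have d0 : 0 < dist (time0 T) t `^ ((N - fsize h)%N%:R * g) by rewrite powR_gt0 ?dist_gt0.
  have [n0 le] := cauchyRZ (divr_gt0 e0 d0).
  exists n0 => m n n0m n0n; apply: (le_trans (le m n n0m n0n h hN _ _ t0)).
  by rewrite divfK // gt_eqF.
have E n : Z_ n t h = r n + transport N.-1 (X_ n (time0 T) t) (Z_ n (time0 T)) h.
  by rewrite /r remainderE subrK.
have c := cvgD cr (cvgn_transport (m := N.-1) (h := h)
  (fun k => @cvg_rough_limit (time0 T) t k) c0).
have c' : Z_ n t h @[n --> \oo] --> limn r + transport N.-1
    (rough_limit (time0 T) t) (fun k => limn (fun n => Z_ n (time0 T) k)) h.
  by apply: (eq_cvgn E); exact: c.
by rewrite (cvg_lim _ c').
Qed.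

Lemma cvg_remainder h s t : remainder alpha (X_ n) (Z_ n) h s t @[n --> \oo] -->
  remainder alpha rough_limit controlled_limit h s t.
Proof.
apply: cvgB; first exact: cvg_controlled_limit.
by apply: cvgn_transport => k; [exact: cvg_rough_limit|exact: cvg_controlled_limit].
Qed.

Lemma controlled_limit_span : path_in_span N.-1 controlled_limit.
Proof.
move=> t h hN; rewrite /controlled_limit.
rewrite (_ : (fun n => Z_ n t h) = cst 0) ?lim_cst //.
by apply/funext => n; exact: spanZ.
Qed.

Lemma controlled_limit_close e : 0 < e -> exists n0, forall n, (n0 <= n)%N ->
  close alpha g e (X_ n, Z_ n) (rough_limit, controlled_limit).
Proof.
move=> e0; have [n0 leX] := rough_limit_rho e0; have [n1 leZ] := cauchyZ0 e0.
have [n2 leR] := cauchyRZ e0; exists (maxn n0 (maxn n1 n2)) => n.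
rewrite !geq_max => /and3P[n0n n1n n2n]; split=> /=; first exact: leX.
  move=> h hN; apply: (cvgn_dist_le (n0 := n1) (@cvg_controlled_limit _ h)) => m n1m.
  exact: leZ.
move=> h hN s t st; apply: (cvgn_dist_le (n0 := n2) (@cvg_remainder h s t)) => m n2m.
exact: leR.
Qed.

End ControlledLimit.
End RoughPathLimit.

(** The intrinsic description of the closure; the two inclusions are [controlled_closure_small] and
    [small_controlled_closure]. *)
Definition remainder_small (b : R) X Z : Prop := forall e, 0 < e ->
  exists2 d, 0 < d & forall s t, s != t -> dist s t <= d ->
    forall h, (fsize h <= N.-1)%N ->
    `|remainder alpha X Z h s t| <= e * dist s t `^ ((N - fsize h)%N%:R * b).

Hypothesis N0 : (0 < N)%N.
Variable beta : R.
Hypothesis beta_alpha : beta < alpha.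

(** Half of [e] pays for an alpha-controlled approximation [W]. The remainder of [W] has the spare
    factor |t-s|^((N-|h|)(alpha-beta)), which is small near the diagonal because N - |h| is at least
    1. *)
Lemma controlled_closure_small X Z :
  controlled_closure alpha beta X Z -> remainder_small beta X Z.
Proof.
move=> [_ app] e e0; have e20 : 0 < e / 2 by rewrite divr_gt0.
have [W [_ /cnorm_ltyP[C WC]]] := app _ e20.
rewrite cnorm_cdist => /cdist_lt_close[_ ZW].
have C0 : 0 <= C.
  by apply: (hbounded_ge0 (WC fone _)); rewrite fsize1.
have [d d0 small] := powR_small (c := alpha - beta) (eta := e / 2 / (C + 1))
  ltac:(by rewrite subr_gt0) ltac:(by rewrite divr_gt0 // ltr_wpDl).
exists d => // s t st le h hN.
rewrite -[X in `|X|](subrK (remainder alpha X W h s t)).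
apply: (le_trans (ler_normD _ _)); rewrite [X in _ <= X * _](splitr e) mulrDl.
apply: lerD; first exact: ZW.
have n0 : (0 < N - fsize h)%N by rewrite subn_gt0 -(prednK N0) ltnS.
apply: (le_trans (WC h hN s t st)).
have -> : (N - fsize h)%N%:R * alpha =
   (N - fsize h)%N%:R * (alpha - beta) + (N - fsize h)%N%:R * beta by ring.
rewrite powRD; last by apply/implyP => _; rewrite gt_eqF ?dist_gt0.
rewrite mulrA ler_wpM2r ?powR_ge0 //.
have c : alpha - beta <= (N - fsize h)%N%:R * (alpha - beta).
  by rewrite ler_peMl ?subr_ge0 ?(ltW beta_alpha) // ler1n.
apply: (le_trans (ler_wpM2l C0 (small (dist s t) _ _ le c))).
  by rewrite dist_gt0.
by rewrite mulrA ler_pdivrMr ?ltr_wpDl // mulrC ler_pM2l // lerDl.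
Qed.

Lemma controlled_closure_bounded X Z : controlled_closure alpha beta X Z ->
  (cnorm alpha beta X Z < +oo)%E.
Proof.
move=> [_ app]; have [W [_ /cnorm_ltyP[C WC]]] := app _ ltr01.
rewrite cnorm_cdist => /cdist_lt_close[_ ZW].
apply: cnorm_lty => h hN.
have bb : (N - fsize h)%N%:R * beta <= (N - fsize h)%N%:R * alpha.
  by rewrite ler_wpM2l // ltW.
exists (1 + C * T%:num `^ ((N - fsize h)%N%:R * alpha - (N - fsize h)%N%:R * beta)).
apply: eq_hbounded (hboundedD (ZW h hN) (hbounded_exp bb (WC h hN))) => s t.
by rewrite subrK.
Qed.

(** Closeness is uniform in the times, so one term of the sequence suffices. The exponent [g] may be
    [alpha] or [beta], and [B] bounds the powers of T lost in passing from [g] to [beta]. *)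
Lemma remainder_small_limit g (X_ : nat -> process A T) (Z_ : nat -> hpath A T) X Z :
  beta <= g -> (forall n, remainder_small beta (X_ n) (Z_ n)) ->
  (forall e, 0 < e -> exists n0, forall n, (n0 <= n)%N ->
     close alpha g e (X_ n, Z_ n) (X, Z)) ->
  remainder_small beta X Z.
Proof.
move=> bg small app e e0.
pose P (m : nat) B := T%:num `^ (m%:R * g - m%:R * beta) <= B.
have mono m a b : a <= b -> P m a -> P m b by move=> ab /le_trans; apply.
have ex m : m \in iota 0 N.+1 -> exists B, P m B by move=> _; eexists; exact: lexx.
have [B B1 TB] := seq_bound mono ex.
have B0 : 0 < B by lra.
have e2 : 0 < e / 2 by rewrite divr_gt0.
have [n0 /(_ n0 (leqnn _))[_ _ /= RZ]] := app _ (divr_gt0 e2 B0).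
have [d d0 le] := small n0 _ e2; exists d => // s t st std h hN.
rewrite -[X in `|X|](subKr (remainder alpha (X_ n0) (Z_ n0) h s t)).
apply: (le_trans (ler_normB _ _)); rewrite [X in _ <= X * _](splitr e) mulrDl.
apply: lerD; first exact: le.
have bb : (N - fsize h)%N%:R * beta <= (N - fsize h)%N%:R * g by rewrite ler_wpM2l.
apply: (le_trans (hbounded_exp bb (RZ h hN) st)).
rewrite ler_wpM2r ?powR_ge0 // mulrAC ler_pdivrMr // ler_pM2l //.
by apply: TB; rewrite mem_iota add0n ltnS leq_subr.
Qed.

End Completeness.

(** * Approximation by controlled paths *)

Section Ramp.
Variable R : realType.
Implicit Types x y : R.

(** The clamp onto [0,1]. With one shifted ramp per grid cell, a piecewise linear path is a plain
    sum, without a choice of the cell containing the time. *)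
Definition ramp x : R := Num.max 0 (Num.min 1 x).

Lemma ramp_id x : 0 <= x <= 1 -> ramp x = x.
Proof. by move=> /andP[x0 x1]; rewrite /ramp (min_idPr x1) (max_idPr x0). Qed.

Lemma ramp_le0 x : x <= 0 -> ramp x = 0.
Proof.
move=> x0; rewrite /ramp (min_idPr _) ?(le_trans x0) //.
exact/max_idPl.
Qed.

Lemma ramp_ge1 x : 1 <= x -> ramp x = 1.
Proof. by move=> x1; rewrite /ramp (min_idPl x1) (max_idPr _). Qed.

Lemma ramp_lipschitz x y : `|ramp x - ramp y| <= `|x - y|.
Proof.
wlog xy : x y / x <= y.
  by move=> th; have [/th //|/ltW/th] := leP x y; rewrite distrC (distrC y).
rewrite distrC (distrC x) (@ger0_norm _ (y - x)) ?subr_ge0 //.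
have [y0|y0] := leP y 0; first by rewrite !ramp_le0 ?(le_trans xy) // subrr normr0 subr_ge0.
have [x1|x1] := leP 1 x; first by rewrite !ramp_ge1 ?(le_trans _ xy) // subrr normr0 subr_ge0.
have [x0|x0] := leP x 0; have [y1|y1] := leP 1 y;
  rewrite ?(ramp_le0 x0) ?(ramp_ge1 y1) ?(@ramp_id y) ?(@ramp_id x) ?ler_norml; lra.
Qed.

Lemma cell_exists m (d x : R) : (0 < m)%N -> 0 <= x <= m%:R * d ->
  exists2 j, (j < m)%N & j%:R * d <= x <= j.+1%:R * d.
Proof.
case: m => // m _; elim: m => [|m IH] /andP[x0 xm].
  by exists 0%N => //; rewrite mul0r x0.
have [le|/ltW le] := leP x (m.+1%:R * d); last by exists m.+1 => //; rewrite le xm.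
have [|j jm jx] := IH; first by rewrite x0 le.
by exists j => //; exact: ltnW.
Qed.

(** Linear interpolation keeps Hoelder bounds of exponent at most 1, since a ratio x/d in [0,1] is
    at most its a-th power. *)
Lemma ratio_powR (x d a : R) : 0 <= x -> x <= d -> 0 < d -> a <= 1 ->
  x / d * d `^ a <= x `^ a.
Proof.
rewrite le_eqVlt => /orP[/eqP <-|x0] xd d0 a1; first by rewrite !mul0r powR_ge0.
rewrite -[in X in _ <= X](divfK (lt0r_neq0 d0) x) powRM ?divr_ge0 ?(ltW x0) ?(ltW d0) //.
rewrite ler_wpM2r ?powR_ge0 // ger1_powR // divr_gt0 //=.
by rewrite ler_pdivrMr // mul1r.
Qed.

End Ramp.

(** * Linear interpolation in the moving frame *)

Section Interpolation.
Variables (R : realType) (A : finType) (T : {posnum R}) (alpha beta : R).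
Hypotheses (alpha0 : 0 < alpha) (beta0 : 0 <= beta) (beta_alpha : beta <= alpha).
Let N := level alpha.
Hypotheses (N0 : (0 < N)%N) (Nalpha : N%:R * alpha <= 1).
Variable X : process A T.
Hypothesis bX : branched_rough_paths alpha X.
Implicit Types (Z W : hpath A T) (h k : forest A) (s t : time T) (e : R).

Let o := time0 T.
Let n := N.-1.
Let nE : n.+1 = N. Proof. exact: prednK. Qed.

(** The path Y of the overview; [unframe] inverts it on forests of size at most [n]. *)
Definition frame Z : hpath A T := fun t => transport n (X t o) (Z t).
Definition unframe Z : hpath A T := fun t => transport n (X o t) (Z t).

Lemma remainder_unframe Z h s t : remainder alpha X (unframe Z) h s t =
  transport n (X o t) (fun k => Z t k - Z s k) h.
Proof.
by rewrite remainderE transportB /unframe (transport_chen _ _ _ _ _ _ bX).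
Qed.

Lemma unframeK Z t h : (fsize h <= n)%N -> unframe (frame Z) t h = Z t h.
Proof.
by move=> hn; rewrite /unframe /frame (transport_chen _ _ _ _ _ _ bX) (transport_diag _ _ bX).
Qed.

Lemma remainder_frame Z h s t : (fsize h <= n)%N -> remainder alpha X Z h s t =
  transport n (X o t) (fun k => frame Z t k - frame Z s k) h.
Proof.
move=> hn; rewrite -remainder_unframe !remainderE unframeK //; congr (_ - _).
by apply: eq_transport => k kn; rewrite unframeK.
Qed.

Section Grid.
Variables (Z : hpath A T) (m : nat).
Hypothesis m0 : (0 < m)%N.
Let d : R := T%:num / m%:R.
Let mR : 0 < m%:R :> R. Proof. by rewrite ltr0n. Qed.
Let d0 : 0 < d. Proof. by rewrite divr_gt0. Qed.
Let dT : m%:R * d = T%:num. Proof. by rewrite mulrC divfK ?gt_eqF. Qed.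

(** The cut-off at T makes the grid point a time for every [i]; it is inactive for [i <= m]. *)
Lemma grid_subproof i : 0 <= Num.min (i%:R * d) T%:num <= T%:num.
Proof. by rewrite le_min ge_min lexx orbT mulr_ge0 ?(ltW d0) //= ge0. Qed.

Definition grid i : time T :=
  exist (fun t : R => is_true (0 <= t <= T%:num)) _ (grid_subproof i).

Lemma val_grid i : (i <= m)%N -> val (grid i) = i%:R * d.
Proof. by move=> im; apply/min_idPl; rewrite -dT ler_pM2r ?ler_nat. Qed.

(* The frame trivializes the transports, so that linear interpolation in the frame
   keeps all the remainders controlled. *)
Definition interpolation : hpath A T := fun t k => frame Z (grid 0) k +
  \sum_(0 <= i < m) ramp (val t / d - i%:R) *
    (frame Z (grid i.+1) k - frame Z (grid i) k).

Definition in_cell j t := j%:R * d <= val t <= j.+1%:R * d.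

Lemma in_cellE j t : in_cell j t = (j%:R <= val t / d <= j.+1%:R).
Proof. by rewrite /in_cell ler_pdivlMr // ler_pdivrMr. Qed.

(** On cell [j] the ramps of the earlier cells are constantly 1 and those of the later cells
    constantly 0. *)
Lemma interpolation_cell j s t k : (j < m)%N -> in_cell j s -> in_cell j t ->
  interpolation t k - interpolation s k =
  (val t - val s) / d * (frame Z (grid j.+1) k - frame Z (grid j) k).
Proof.
rewrite !in_cellE /= => jm /andP[s1 s2] /andP[t1 t2].
rewrite /interpolation opprD addrACA subrr add0r -sumrB.
rewrite (bigD1_seq j) ?iota_uniq ?mem_index_iota //= big1 ?addr0 => [|i ij].
  rewrite -mulrBl !ramp_id; first by congr (_ * _); ring.
    by rewrite subr_ge0 s1 lerBlDr addrC natr1.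
  by rewrite subr_ge0 t1 lerBlDr addrC natr1.
have [lt|lt|eq] := ltngtP i j; last by rewrite eq eqxx in ij.
  have ge : i%:R + 1 <= j%:R :> R by rewrite natr1 ler_nat.
  by rewrite !ramp_ge1 ?subrr //; lra.
have ge : j.+1%:R <= i%:R :> R by rewrite ler_nat.
by rewrite !ramp_le0 ?subrr //; lra.
Qed.

Lemma interpolation_grid j k : (j <= m)%N ->
  interpolation (grid j) k = frame Z (grid j) k.
Proof.
move=> jm; rewrite /interpolation val_grid // mulfK ?gt_eqF //.
rewrite (big_cat_nat (n := j)) //= [X in _ + (_ + X)]big_nat_cond.
rewrite [X in _ + (_ + X)]big1 ?addr0 => [|i /andP[/andP[ji _] _]]; last first.
  have ge : j%:R <= i%:R :> R by rewrite ler_nat.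
  by rewrite ramp_le0 ?mul0r //; lra.
rewrite (eq_big_nat _ _ (F2 := fun i => frame Z (grid i.+1) k - frame Z (grid i) k)).
  by rewrite telescope_sumr // addrC subrK.
move=> i /andP[_ ij]; have ge : i%:R + 1 <= j%:R :> R by rewrite natr1 ler_nat.
by rewrite ramp_ge1 ?mul1r //; lra.
Qed.

Lemma interpolation_lipschitz : exists2 L, 0 <= L & forall k, (fsize k <= n)%N ->
  forall s t, `|interpolation t k - interpolation s k| <= L * dist s t.
Proof.
pose P k L := forall s t, `|interpolation t k - interpolation s k| <= L * dist s t.
have mono k a b : a <= b -> P k a -> P k b.
  by move=> ab Pa s t; apply: (le_trans (Pa s t)); rewrite ler_wpM2r ?dist_ge0.
have ex k : k \in forest_seq A n -> exists L, P k L.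
  move=> _; exists (\sum_(0 <= i < m) d^-1 *
    `|frame Z (grid i.+1) k - frame Z (grid i) k|) => s t.
  rewrite /interpolation opprD addrACA subrr add0r -sumrB mulr_suml.
  apply: (le_trans (ler_norm_sum _ _ _)); apply: ler_sum => i _.
  rewrite -mulrBl normrM mulrAC ler_wpM2r //.
  apply: (le_trans (ramp_lipschitz _ _)); rewrite (_ : _ - _ = (val t - val s) / d) /=; last by ring.
  by rewrite normrM (ger0_norm (_ : 0 <= d^-1)) ?invr_ge0 ?(ltW d0) // mulrC.
have [L L1 bnd] := seq_bound mono ex.
by exists L; [lra | move=> k kn; apply: bnd; rewrite mem_forest_seq].
Qed.

Lemma interpolation_controlled : controlled alpha X (unframe interpolation).
Proof.
split.
  by move=> t h hn; apply: transport_out; rewrite ltnNge; apply/negP.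
have [L L0 lip] := interpolation_lipschitz.
(* With weight exponent 0 all powers in [transport_bound] equal 1: transports are bounded, and
   Lipschitz increments in the frame give remainders of order |t-s|. *)
have alphaW : 0 <= (0 : R) <= alpha by rewrite lexx ltW.
have [C C0 bnd] := transport_bound alpha0 n alphaW bX.
apply: cnorm_lty => h hn.
have e1 : (N - fsize h)%N%:R * alpha <= 1.
  by apply: le_trans Nalpha; rewrite ler_pM2r // ler_nat leq_subr.
eexists; apply: (hbounded_exp e1 (C := C * L)) => s t st.
rewrite remainder_unframe powRr1 ?dist_ge0 // -mulrA.
have := bnd (L * dist s t) T%:num (fun k => interpolation t k - interpolation s k) o t.
move=> /(_ (mulr_ge0 L0 (dist_ge0 s t)) (gt0 T) (lexx _) (dist_le o t)) le.
have := le _ h hn; rewrite mulr0 powRr0 mulr1; apply => k kn.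
by rewrite mulr0 powRr0 mulr1; exact: lip.
Qed.

Section Estimate.
Variables (C w : R).
Hypothesis C0 : 0 <= C.
Hypothesis w0 : 0 <= w.
Hypothesis bound : forall w tau (r : forest A -> R) s t,
  0 <= w -> 0 < tau -> tau <= T%:num -> dist s t <= tau ->
  (forall k, (fsize k <= n)%N -> `|r k| <= w * tau `^ ((N - fsize k)%N%:R * beta)) ->
  forall h, (fsize h <= n)%N -> `|transport n (X s t) r h| <=
     C * w * tau `^ ((N - fsize h)%N%:R * beta).
Hypothesis small : forall s t, s != t -> dist s t <= d ->
  forall h, (fsize h <= n)%N ->
  `|remainder alpha X Z h s t| <= w * dist s t `^ ((N - fsize h)%N%:R * beta).

(** The interpolation error seen in the frame; [G] is then the difference of the two remainders to
    be estimated. *)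
Let V t k := frame Z t k - interpolation t k.
Let G s t := transport n (X o t) (fun k => V t k - V s k).

Let C1 := 1 + C.
Let C10 : 0 <= C1. Proof. by rewrite addr_ge0. Qed.

Lemma expo_le1 h : (N - fsize h)%N%:R * beta <= 1.
Proof.
apply: le_trans Nalpha; apply: ler_pM => //.
by rewrite ler_nat leq_subr.
Qed.

Lemma expo_ge0 h : 0 <= (N - fsize h)%N%:R * beta.
Proof. by rewrite mulr_ge0. Qed.

(** The remainder of [Z] is small by hypothesis, and the interpolation contributes the fraction
    |t-s|/d of the increment over the whole cell, to which [ratio_powR] applies. *)
Lemma G_cell j s t h : (fsize h <= n)%N -> (j < m)%N -> in_cell j s -> in_cell j t ->
  `|G s t h| <= C1 * w * dist s t `^ ((N - fsize h)%N%:R * beta).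
Proof.
move=> hn jm js jt; have [st|st] := eqVneq s t.
  rewrite /G st (@eq_transport _ _ _ _ _ (fun k => 0 * V t k)) => [|k _].
    by rewrite transportZ mul0r normr0 !mulr_ge0 ?powR_ge0.
  by rewrite subrr mul0r.
have dst : dist s t <= d.
  move: js jt; rewrite /in_cell /dist ler_norml -natr1 mulrDl mul1r.
  by move=> /andP[? ?] /andP[? ?]; apply/andP; split; lra.
pose D k := frame Z (grid j.+1) k - frame Z (grid j) k.
have E : G s t h = remainder alpha X Z h s t -
    (val t - val s) / d * transport n (X o t) D h.
  rewrite remainder_frame // -transportZ -transportB; apply: eq_transport => k _.
  by rewrite -(interpolation_cell k jm js jt) /V; ring.
have dg : dist (grid j) (grid j.+1) = d.
  rewrite /dist !val_grid // 1?ltnW // -natr1 mulrDl mul1r addrC addKr.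
  by rewrite ger0_norm // ltW.
have gj : grid j != grid j.+1 by rewrite -dist_gt0 dg.
have gt : dist (grid j.+1) t <= d.
  rewrite /dist val_grid //; move: jt; rewrite /in_cell ler_norml -natr1 mulrDl mul1r.
  by move=> /andP[? ?]; apply/andP; split; lra.
have dT' : d <= T%:num by rewrite -dT ler_peMl ?(ltW d0) // ler1n.
have le : `|transport n (X o t) D h| <= C * w * d `^ ((N - fsize h)%N%:R * beta).
  (* Passing through the right end of the cell exhibits the remainder of [Z] over the cell,
     transported to [t] over a distance at most [d]. *)
  rewrite -(transport_chen n o t (grid j.+1) D h bX).
  apply: (bound w0 d0 dT' gt) => // k kn; rewrite -remainder_frame // -[in X in _ <= X]dg.
  by apply: small => //; rewrite dg.
rewrite E; apply: (le_trans (ler_normB _ _)).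
have -> x : C1 * w * x = w * x + C * w * x by rewrite /C1; ring.
apply: lerD; first exact: small.
rewrite normrM normrM -/(dist s t) (ger0_norm (_ : 0 <= d^-1)) ?invr_ge0 ?(ltW d0) //.
apply: (le_trans (ler_wpM2l _ le)); first by rewrite divr_ge0 ?dist_ge0 ?(ltW d0).
rewrite mulrCA ler_wpM2l ?mulr_ge0 //.
by apply: ratio_powR => //; [exact: dist_ge0|exact: expo_le1].
Qed.

Lemma V_grid j k : (j <= m)%N -> V (grid j) k = 0.
Proof. by move=> jm; rewrite /V interpolation_grid // subrr. Qed.

(** The error vanishes at grid points, so between different cells only the piece from [s] to the
    next grid point and the piece from the last grid point to [t] remain. The second costs [C1], the
    first [C * C1] since it is transported to [t]. *)
Lemma G_ordered s t h : (fsize h <= n)%N -> val s < val t ->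
  `|G s t h| <= (C1 + C * C1) * w * dist s t `^ ((N - fsize h)%N%:R * beta).
Proof.
move=> hn st; have dE : dist s t = val t - val s by rewrite /dist ger0_norm // subr_ge0 ltW.
have cell u : exists2 j, (j < m)%N & in_cell j u.
  by apply: cell_exists => //; rewrite dT; exact: (valP u).
have [i im si] := cell s; have [j jm tj] := cell t.
have C1C : C1 <= C1 + C * C1 by rewrite lerDl mulr_ge0.
have [ti|ti] := leP (val t) (i.+1%:R * d).
  have : in_cell i t.
    by move: si; rewrite /in_cell ti andbT => /andP[/le_trans le _]; apply/le/ltW.
  move=> /(G_cell hn im si)/le_trans; apply.
  by rewrite ler_wpM2r ?powR_ge0 // ler_wpM2r.
have ij : (i < j)%N.
  rewrite -ltnS -(ltr_nat R) -(ltr_pM2r d0); apply: lt_le_trans ti _.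
  by case/andP: tj.
have ge : i.+1%:R * d <= j%:R * d by rewrite ler_pM2r // ler_nat.
move: (si) (tj); rewrite /in_cell => /andP[si1 si2] /andP[tj1 tj2].
have vi := val_grid im; have vj := val_grid (ltnW jm).
have d1 : dist (grid j) t <= dist s t.
  by rewrite dE /dist vj ger0_norm; lra.
have d2 : dist (grid i.+1) t <= dist s t.
  by rewrite dE /dist vi ger0_norm; lra.
have d3 : dist s (grid i.+1) <= dist s t.
  by rewrite dE /dist vi ger0_norm; lra.
have st0 : 0 < dist s t by rewrite dE subr_gt0.
have E : G s t h = G (grid j) t h + transport n (X (grid i.+1) t) (G s (grid i.+1)) h.
  rewrite /G (transport_chen n o t (grid i.+1) _ h bX) -transportD.
  by apply: eq_transport => k _; rewrite !V_grid ?(ltnW jm) //; ring.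
rewrite E mulrDl mulrDl; apply: (le_trans (ler_normD _ _)); apply: lerD.
  apply: (@le_trans _ _ (C1 * w * dist (grid j) t `^ ((N - fsize h)%N%:R * beta))).
    by apply: (G_cell (j := j)) => //; rewrite /in_cell vj lexx ler_pM2r // ler_nat leqnSn.
  by rewrite ler_wpM2l ?mulr_ge0 // powR_le_base ?expo_ge0 ?dist_ge0.
rewrite -[C * C1 * w]mulrA.
apply: (bound (mulr_ge0 C10 w0) st0 (dist_le s t) d2) => // k kn.
apply: (@le_trans _ _ (C1 * w * dist s (grid i.+1) `^ ((N - fsize k)%N%:R * beta))).
  by apply: (G_cell (j := i)) => //; rewrite /in_cell vi lexx andbT ler_pM2r // ler_nat leqnSn.
by rewrite ler_wpM2l ?mulr_ge0 // powR_le_base ?expo_ge0 ?dist_ge0.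
Qed.

Lemma interpolation_close h : (fsize h <= n)%N ->
  hbounded ((N - fsize h)%N%:R * beta) ((1 + C) * (C1 + C * C1) * w)
    (fun s t => remainder alpha X Z h s t - remainder alpha X (unframe interpolation) h s t).
Proof.
move=> hn s t st; have -> : remainder alpha X Z h s t -
    remainder alpha X (unframe interpolation) h s t = G s t h.
  rewrite remainder_frame // remainder_unframe -transportB; apply: eq_transport => k _.
  by rewrite /V; ring.
set B := C1 + C * C1; have B0 : 0 <= B by rewrite addr_ge0 ?mulr_ge0.
have Bw := mulr_ge0 B0 w0.
have [lt|le] := ltP (val s) (val t).
  apply: (le_trans (G_ordered hn lt)); rewrite ler_wpM2r ?powR_ge0 //.
  by rewrite (_ : (1 + C) * B * w = B * w + C * (B * w)) ?lerDl ?mulr_ge0 //; ring.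
have lt : val t < val s by rewrite lt_neqAle le andbT; apply: contra_neq st => /val_inj.
(* Reversed times cost one further transport, which accounts for the factor 1 + C. *)
have E : G s t h = - transport n (X s t) (G t s) h.
  rewrite /G (transport_chen n o t s _ h bX) -mulN1r -transportZ.
  by apply: eq_transport => k _; ring.
have st0 : 0 < dist s t by rewrite dist_gt0.
have -> x : (1 + C) * B * w * x = B * w * x + C * (B * w) * x by ring.
rewrite E normrN -[X in X <= _]add0r; apply: lerD.
  by rewrite mulr_ge0 ?powR_ge0.
apply: (bound Bw st0 (dist_le s t) (lexx _)) => // k kn; rewrite distC.
exact: G_ordered.
Qed.

End Estimate.
End Grid.

Lemma small_controlled_closure Z : path_in_span n Z ->
  remainder_small alpha beta X Z -> controlled_closure alpha beta X Z.
Proof.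
move=> spZ small; split=> // e e0.
have bb : 0 <= beta <= alpha by rewrite beta0.
have [C C0 bnd] := transport_bound alpha0 n bb bX.
(* The constant of [interpolation_close] times that of [close_cdist_le]; [w] below makes c w
   strictly less than [e]. *)
pose c := (1 + C) * (1 + C + C * (1 + C)) * (2 * size (forest_seq A n))%:R.
have c0 : 0 <= c by rewrite !(mulr_ge0, addr_ge0).
pose w := e / (c + 1) / 2.
have w0 : 0 < w by rewrite !divr_gt0 // ltr_wpDl.
have [d d0 wd] := small _ w0.
pose m := (Num.truncn (T%:num / d)).+1.
have md : T%:num / m%:R <= d.
  rewrite ler_pdivrMr ?ltr0n // mulrC -ler_pdivrMr // ltW //.
  by have /truncn_itv/andP[] : 0 <= T%:num / d by rewrite divr_ge0 // ltW.
have m0 : (0 < m)%N by [].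
exists (unframe (interpolation Z m0)); first exact: interpolation_controlled.
rewrite cnorm_cdist; apply: (@le_lt_trans _ _ (c * w)%:E).
  have -> : c * w = (1 + C) * (1 + C + C * (1 + C)) * w * (2 * size (forest_seq A n))%:R.
    by rewrite /c; ring.
  apply: close_cdist_le => h hn.
    (* Time 0 is a grid point, so the initial values agree exactly. *)
    have g0 : grid m0 0 = o by apply/val_inj; rewrite val_grid // mul0r.
    have -> : unframe (interpolation Z m0) (time0 T) h = Z (time0 T) h.
      rewrite -[in RHS](unframeK Z (time0 T) hn); apply: eq_transport => k _.
      by rewrite -/o -g0 interpolation_grid.
    rewrite subrr normr0; apply: mulr_ge0 (ltW w0).
    by rewrite !(mulr_ge0, addr_ge0).
  apply: interpolation_close => //; first exact: ltW.
    by move: bnd; rewrite nE.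
  by move=> s t st std k kn; apply: wd => //; apply: le_trans md.
rewrite lte_fin /w.
have cc : c / (c + 1) <= 1 by rewrite ler_pdivrMr ?ltr_wpDl // mul1r lerDl.
have : c / (c + 1) * e <= e by rewrite ler_piMl // ltW.
have -> : c * (e / (c + 1) / 2) = c / (c + 1) * e / 2 by ring.
by lra.
Qed.

End Interpolation.

(** * Geometric rough paths *)

(* No measurability is assumed: the integral of a nonnegative function is a
   supremum over the simple functions below it, hence monotone. *)
Lemma normr_Rintegral_le (R : realType) (a b C : R) (f : R -> R) :
  a <= b -> (forall r, a <= r <= b -> `|f r| <= C) ->
  `|\int[lebesgue_measure]_(r in `[a, b]) f r| <= C * (b - a).
Proof.
move=> ab fC; have C0 : 0 <= C.
  by apply: le_trans (fC a _); rewrite ?lexx.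
have mono (g : R -> \bar R) : (forall r, 0 <= g r)%E ->
    (forall r, (a <= r <= b)%R -> (g r <= C%:E)%E) ->
    (0 <= \int[lebesgue_measure]_(r in `[a, b]) g r <= (C * (b - a))%:E)%E.
  move=> g0 gC; rewrite integral_ge0 //=.
  have -> : (C * (b - a))%:E = (\int[lebesgue_measure]_(r in `[a, b]) (cst C%:E) r)%E.
    rewrite integral_cst //= lebesgue_measure_itv /= lte_fin EFinM.
    by case: ltP => [//|ba]; rewrite (_ : b - a = 0) //; lra.
  have C0' (r : R) : `[a, b]%classic r -> (0 <= cst C%:E r)%E by rewrite lee_fin.
  rewrite !ge0_integralE //=.
  apply: le_ereal_sup => _ [h hg <-]; exists h => // r; apply: (le_trans (hg r)).
  by rewrite /patch; case: ifPn => // /set_mem; rewrite /= in_itv /= => rab; exact: gC.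
rewrite /Rintegral integralE.
set g : R -> \bar R := fun r => (f r)%:E.
have bnd r : a <= r <= b -> (g^\+ r <= C%:E)%E /\ (g^\- r <= C%:E)%E.
  move=> /fC; rewrite ler_norml => /andP[fC1 fC2].
  by rewrite funeposE funenegE /g !ge_max !lee_fin C0 fC2 lerNl fC1.
have fin (I : \bar R) : (0 <= I <= (C * (b - a))%:E)%E ->
    exists2 p, I = p%:E & 0 <= p <= C * (b - a).
  move=> /andP[I0 IC]; have If : I \is a fin_num.
    by rewrite ge0_fin_numE // (le_lt_trans IC) ?ltry.
  by exists (fine I); rewrite ?fineK // -!lee_fin !fineK // I0.
have [p -> /andP[p0 pC]] := fin _ (mono _ (funepos_ge0 g) (fun r h => (bnd r h).1)).
have [q -> /andP[q0 qC]] := fin _ (mono _ (funeneg_ge0 g) (fun r h => (bnd r h).2)).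
by rewrite /= ler_norml; apply/andP; split; lra.
Qed.

Section CanonicalLift.
Variables (R : realType) (A : finType) (T : {posnum R}).
Implicit Types (X Y : process A T) (h k : forest A) (s t : time T) (e : R).

Lemma normr_oriented_integral_le s t (f : R -> R) (C : R) :
  (forall u : time T, dist s u <= dist s t -> `|f (val u)| <= C) ->
  `|oriented_integral (val s) (val t) f| <= C * dist s t.
Proof.
have sT := valP s; have tT := valP t => fC.
have pt r : 0 <= r <= T%:num -> `|r - val s| <= dist s t -> `|f r| <= C.
  by move=> rT; apply: (fC (exist (fun t : R => is_true (0 <= t <= T%:num)) r rT)).
rewrite /oriented_integral; case: (leP (val s) (val t)) => st.
  have dE : dist s t = val t - val s by rewrite /dist ger0_norm ?subr_ge0.
  rewrite dE; apply: normr_Rintegral_le => // r /andP[sr rt].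
  apply: pt; first by case/andP: sT => ? _; case/andP: tT => _ ?; apply/andP; split; lra.
  have h1 : 0 <= r - val s by lra.
  have h2 : 0 <= val t - val s by lra.
  by rewrite /dist (ger0_norm h1) (ger0_norm h2); lra.
have dE : dist s t = val s - val t by rewrite distC /dist ger0_norm ?subr_ge0 ?ltW.
rewrite normrN dE.
apply: normr_Rintegral_le => [|r /andP[sr rt]]; first exact: ltW.
apply: pt; first by case/andP: tT => ? _; case/andP: sT => _ ?; apply/andP; split; lra.
have h1 : r - val s <= 0 by lra.
have h2 : val t - val s <= 0 by lra.
by rewrite /dist (ler0_norm h1) (ler0_norm h2); lra.
Qed.

Lemma smooth_derive_bounded (x : A -> R -> R) a : smooth x ->
  exists2 M, 0 <= M & forall t, `|(x a)^`()%classic (val t)| <= M.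
Proof.
move=> sx; have T0 : 0 <= T%:num by [].
have cf : {within `[0, T%:num], continuous (x a)^`()%classic}.
  apply: derivable_within_continuous => r _.
  by have := sx a 1%N r; rewrite derive1n1.
have cx : {within `[0, T%:num], continuous (fun r => `|(x a)^`()%classic r|)}.
  move=> r; apply: continuous_comp; first exact: cf.
  exact: norm_continuous.
have [c _ le] := EVT_max T0 cx.
exists `|(x a)^`()%classic c| => // t; apply: le.
by rewrite in_itv /=; exact: (valP t).
Qed.

(** Each integration against a bounded derivative gains a factor |t-s|, and characters multiply the
    bounds of the factors. *)
Lemma canonical_lift_bound x Y h : smooth x -> canonical_lift x Y ->
  exists2 C, 0 <= C & forall s t, `|Y s t h| <= C * dist s t ^+ fsize h.
Proof.
move=> sx [charY liftY]; elim/forest_ind: h => [|a h [C C0 IH]|h k [C C0 IHh] [D D0 IHk]].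
- exists 1 => // s t; have [-> _] := charY s t.
  by rewrite fsize1 expr0 mulr1 normr1.
- have [M M0 xM] := smooth_derive_bounded a sx.
  exists (C * M); first exact: mulr_ge0.
  move=> s t; rewrite liftY fsize_graft exprSr mulrA.
  apply: normr_oriented_integral_le => u us.
  rewrite (insubT (fun t : R => 0 <= t <= T%:num) (valP u)) /= normrM [X in _ <= X]mulrAC.
  have -> : Sub (val u) (valP u) = u by apply/val_inj; rewrite SubK.
  apply: ler_pM => //; last exact: (xM u).
  apply: (le_trans (IH s u)); rewrite ler_wpM2l //.
  by apply: lerXn2r => //; rewrite nnegrE dist_ge0.
- exists (C * D); first exact: mulr_ge0.
  move=> s t; have [_ ->] := charY s t.
  by rewrite normrM fsizeM exprD mulrACA; apply: ler_pM.
Qed.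

Variable alpha : R.
Hypotheses (alpha0 : 0 < alpha) (alpha1 : alpha < 1).

Definition rough_small X : Prop := forall e, 0 < e ->
  exists2 d, 0 < d & forall s t, s != t -> dist s t <= d ->
    forall h, h != fone -> (fsize h <= level alpha)%N ->
    `|X s t h| <= e * dist s t `^ ((fsize h)%:R * alpha).

(** An approximating canonical lift is of order |t-s|^|h|, which beats |t-s|^(alpha |h|) because
    alpha < 1 and [h] is not the unit. *)
Lemma geometric_small X : geometric_rough_paths alpha X -> rough_small X.
Proof.
move=> [_ app] e e0; have e20 : 0 < e / 2 by rewrite divr_gt0.
have [x [Y [sx lY /ltW/rho_leP XY]]] := app _ e20.
pose P h C := forall s t, `|Y s t h| <= C * dist s t ^+ fsize h.
have mono h a b : a <= b -> P h a -> P h b.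
  by move=> ab Pa s t; apply: (le_trans (Pa s t)); rewrite ler_wpM2r ?exprn_ge0 ?dist_ge0.
have ex h : h \in forest_seq A (level alpha) -> exists C, P h C.
  by move=> _; have [C _ YC] := canonical_lift_bound h sx lY; exists C.
have [C C1 bnd] := seq_bound mono ex.
have C0 : 0 < C by lra.
have a1 : 0 < 1 - alpha by rewrite subr_gt0.
have [d d0 small] := powR_small a1 (divr_gt0 e20 C0).
exists d => // s t st std h h1 hN; have dst : 0 < dist s t by rewrite dist_gt0.
rewrite -[X s t h](subrK (Y s t h)); apply: (le_trans (ler_normD _ _)).
rewrite [in X in _ <= X](splitr e) mulrDl; apply: lerD; first exact: XY.
have hr : h \in forest_seq A (level alpha) by rewrite mem_forest_seq.
apply: (le_trans (bnd h hr s t)); rewrite -powR_mulrn ?dist_ge0 //.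
have -> : (fsize h)%:R = (fsize h)%:R * (1 - alpha) + (fsize h)%:R * alpha :> R by ring.
rewrite powRD; last by apply/implyP => _; rewrite gt_eqF.
rewrite mulrA -mulrDr subrK mulr1 ler_wpM2r ?powR_ge0 // mulrC -ler_pdivlMr //.
apply: small => //; rewrite ler_peMl ?(ltW a1) // ler1n.
by rewrite fsize_gt0.
Qed.

End CanonicalLift.

(** * Bounded Hoelder continuous functions of two times *)

Section HolderContinuity.
Variables (R : realType) (T : {posnum R}) (g : R).
Implicit Types (F G : time T -> time T -> R) (s t : time T) (C : R).

(** Boundedness is included so that the class is stable under products. *)
Definition holder_continuous F : Prop := exists C, [/\ 0 <= C,
  forall s t, `|F s t| <= C &
  forall s t s' t', `|F s t - F s' t'| <= C * (dist s s' `^ g + dist t t' `^ g)].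

Let gap_ge0 s t s' t' : 0 <= dist s s' `^ g + dist t t' `^ g.
Proof. by rewrite addr_ge0 ?powR_ge0. Qed.

Lemma holder_continuous_cst (c : R) : holder_continuous (fun _ _ => c).
Proof.
exists `|c|; split=> // s t s' t'.
by rewrite subrr normr0 mulr_ge0.
Qed.

Lemma holder_continuousD F G : holder_continuous F -> holder_continuous G ->
  holder_continuous (fun s t => F s t + G s t).
Proof.
move=> [C [C0 FC FC']] [D [D0 GD GD']]; exists (C + D); split=> [|s t|s t s' t'].
- exact: addr_ge0.
- by apply: (le_trans (ler_normD _ _)); exact: lerD.
- rewrite opprD addrACA mulrDl; apply: (le_trans (ler_normD _ _)); exact: lerD.
Qed.

Lemma holder_continuousM F G : holder_continuous F -> holder_continuous G ->
  holder_continuous (fun s t => F s t * G s t).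
Proof.
move=> [C [C0 FC FC']] [D [D0 GD GD']]; exists (2 * C * D + C * D); split=> [|s t|s t s' t'].
- by rewrite !(addr_ge0, mulr_ge0).
- rewrite normrM; apply: (le_trans (ler_pM _ _ (FC s t) (GD s t))) => //.
  by rewrite lerDr !mulr_ge0.
- have -> : F s t * G s t - F s' t' * G s' t' =
    F s t * (G s t - G s' t') + (F s t - F s' t') * G s' t' by ring.
  apply: (le_trans (ler_normD _ _)); rewrite !normrM.
  have := ler_pM (normr_ge0 _) (normr_ge0 _) (FC s t) (GD' s t s' t').
  have := ler_pM (normr_ge0 _) (normr_ge0 _) (FC' s t s' t') (GD s' t').
  have := gap_ge0 s t s' t'; set w := dist s s' `^ g + _ => w0 le1 le2.
  apply: (le_trans (lerD le2 le1)); rewrite -subr_ge0.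
  by rewrite (_ : _ - _ = C * D * w); [rewrite !mulr_ge0 | ring].
Qed.

Lemma holder_continuous_sum (I : Type) (r : seq I) (P : pred I) (F : I -> time T -> time T -> R) :
  (forall i, holder_continuous (F i)) ->
  holder_continuous (fun s t => \sum_(i <- r | P i) F i s t).
Proof.
move=> hF; elim: r => [|i r IH].
  have [C [C0 b1 b2]] := holder_continuous_cst 0.
  exists C; split=> // [s t|s t s' t']; rewrite !big_nil; [exact: (b1 s t)|exact: b2].
case Pi : (P i).
  have [C [C0 b1 b2]] := holder_continuousD (hF i) IH.
  by exists C; split=> // [s t|s t s' t']; rewrite !big_cons !Pi; [exact: b1|exact: b2].
have [C [C0 b1 b2]] := IH.
by exists C; split=> // [s t|s t s' t']; rewrite !big_cons !Pi; [exact: b1|exact: b2].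
Qed.

Hypothesis g0 : 0 < g.

Lemma holder_continuous_uniform F e : holder_continuous F -> 0 < e ->
  exists2 d, 0 < d & forall s t s' t', dist s s' <= d -> dist t t' <= d ->
    `|F s t - F s' t'| <= e.
Proof.
move=> [C [C0 _ FC]] e0; have C1 : 0 < 2 * (C + 1) by rewrite mulr_gt0 ?ltr_wpDl.
have [d d0 small] := powR_small g0 (divr_gt0 e0 C1).
have bnd s s' : dist s s' <= d -> dist s s' `^ g <= e / (2 * (C + 1)).
  move=> le; have := dist_ge0 s s'; rewrite le_eqVlt => /orP[/eqP <-|d1].
    by rewrite powR0 ?gt_eqF // divr_ge0 // ltW.
  exact: small.
exists d => // s t s' t' ss' tt'; apply: (le_trans (FC s t s' t')).
apply: (@le_trans _ _ (C * (e / (2 * (C + 1)) + e / (2 * (C + 1))))).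
  by rewrite ler_wpM2l // lerD ?bnd.
rewrite (_ : C * _ = e * (C / (C + 1))); last by field; lra.
by rewrite ler_piMr ?(ltW e0) // ler_pdivrMr ?ltr_wpDl // mul1r lerDl.
Qed.

End HolderContinuity.

(** * Coding by countably many data *)

Section RoughHolderContinuity.
Variables (R : realType) (A : finType) (T : {posnum R}) (alpha beta : R).
Hypotheses (beta0 : 0 < beta) (beta_alpha : beta <= alpha).
Variable X : process A T.
Hypothesis bX : branched_rough_paths alpha X.
Implicit Types (h k : forest A) (s t : time T) (z : forest A -> R).

Let unit := dirac_forest (A := A) R fone.

Lemma branched_near_unit n : exists2 C, 0 <= C & forall k, (fsize k <= n)%N ->
  forall s t, `|X s t k - unit k| <= C * dist s t `^ beta.
Proof.
pose P k C := forall s t, `|X s t k - unit k| <= C * dist s t `^ beta.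
have mono k a b : a <= b -> P k a -> P k b.
  by move=> ab Pa s t; apply: (le_trans (Pa s t)); rewrite ler_wpM2r ?powR_ge0.
have ex k : k \in forest_seq A n -> exists C, P k C.
  move=> _; have [k1|k1] := eqVneq k fone.
    exists 0 => s t; rewrite k1 (branched1 s t bX) /unit /dirac_forest eqxx.
    by rewrite subrr normr0 mul0r.
  have [_ _ /(_ k)/holder_ltyP[K XK]] := bX.
  have bk : beta <= alpha * (fsize k)%:R.
    apply: (le_trans beta_alpha); rewrite ler_peMr ?ler1n ?fsize_gt0 //.
    by apply: le_trans beta_alpha; exact: ltW.
  exists (K * T%:num `^ (alpha * (fsize k)%:R - beta)) => s t.
  have [<-|st] := eqVneq s t.
    rewrite (branched_diag s bX) subrr normr0 !mulr_ge0 ?powR_ge0 //.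
    exact: hbounded_ge0 XK.
  rewrite /unit /dirac_forest (negbTE k1) subr0.
  exact: (hbounded_exp bk XK).
have [C C1 bnd] := seq_bound mono ex.
by exists C; [lra | move=> k kn; apply: bnd; rewrite mem_forest_seq].
Qed.

(** By Chen's relation, moving [t] to [t'] multiplies [X s t] on the right by [X t t'], which is
    near the counit by [branched_near_unit]; moving [s] acts likewise on the left. *)
Lemma rough_holder_continuous h : holder_continuous beta (fun s t => X s t h).
Proof.
have [C C0 near] := branched_near_unit (fsize h).
pose M := C * T%:num `^ beta + 1.
have M0 : 0 <= M by rewrite addr_ge0 ?mulr_ge0 ?powR_ge0.
have XM k : (fsize k <= fsize h)%N -> forall s t, `|X s t k| <= M.
  move=> kh s t; rewrite -[X s t k](subrK (unit k)).
  apply: (le_trans (ler_normD _ _)); apply: lerD.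
    apply: (le_trans (near k kh s t)); rewrite ler_wpM2l //.
    by rewrite powR_le_base ?(ltW beta0) ?dist_ge0 ?dist_le.
  by rewrite /unit /dirac_forest; case: eqP; rewrite ?normr1 ?normr0.
pose L := \sum_(p <- coprod h) M * C.
have L0 : 0 <= L by apply: sumr_ge0 => p _; rewrite mulr_ge0.
have [_ chX _] := bX.
have right s t t' : `|X s t h - X s t' h| <= L * dist t t' `^ beta.
  rewrite distrC -[X s t](star_counitr) -(chX s t t') /star -sumrB.
  apply: (le_trans (ler_norm_sum _ _ _)); rewrite mulr_suml big_seq [X in _ <= X]big_seq.
  apply: ler_sum => p /coprod_fsize ph; rewrite -mulrBr normrM -mulrA.
  by apply: ler_pM => //; [apply: XM|apply: near]; rewrite -ph ?leq_addr ?leq_addl.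
have left s s' t : `|X s t h - X s' t h| <= L * dist s s' `^ beta.
  rewrite distrC distC -[X s t](star_counitl) -(chX s' s t) /star -sumrB.
  apply: (le_trans (ler_norm_sum _ _ _)); rewrite mulr_suml big_seq [X in _ <= X]big_seq.
  apply: ler_sum => p /coprod_fsize ph; rewrite -mulrBl normrM mulrC -mulrA.
  by apply: ler_pM => //; [apply: XM|apply: near]; rewrite -ph ?leq_addr ?leq_addl.
exists (L + M); split=> [|s t|s t s' t'].
- exact: addr_ge0.
- by apply: (le_trans (XM h (leqnn _) s t)); rewrite lerDr.
- rewrite -[X s t h - _](subrKA (X s t' h)) addrC; apply: (le_trans (ler_normD _ _)).
  rewrite mulrDr; apply: lerD.
    by apply: (le_trans (left _ _ _)); rewrite ler_wpM2r ?powR_ge0 // lerDl.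
  by apply: (le_trans (right _ _ _)); rewrite ler_wpM2r ?powR_ge0 // lerDl.
Qed.

Lemma transport_near_unit n : exists2 C, 0 <= C & forall w z s t, 0 <= w ->
  (forall k, (fsize k <= n)%N -> `|z k| <= w) -> forall h, (fsize h <= n)%N ->
  `|transport n (X s t) z h - z h| <= C * w * dist s t `^ beta.
Proof.
have [C C0 near] := branched_near_unit n.
exists (\sum_(k <- forest_seq A n) \sum_(p <- coprod k) C).
  by apply: sumr_ge0 => k _; exact: sumr_ge0.
move=> w z s t w0 zw h hn; rewrite -[X in _ - X](transport_counit (n := n)) //.
rewrite !transportE -sumrB -mulrA mulr_suml big_seq [X in _ <= X]big_seq.
apply: (le_trans (ler_norm_sum _ _ _)); apply: ler_sum => k.
rewrite mem_forest_seq => kn; rewrite -sumrB.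
apply: (le_trans (ler_norm_sum _ _ _)); rewrite mulr_suml.
rewrite big_mkcond /= big_seq [X in _ <= X]big_seq; apply: ler_sum => p /coprod_fsize pk.
case: eqP => [_|_]; last by rewrite !mulr_ge0 ?powR_ge0.
rewrite -mulrBl normrM (_ : C * _ = C * dist s t `^ beta * w); last by ring.
apply: ler_pM => //.
  by apply: near; rewrite (leq_trans _ kn) // -pk leq_addr.
exact: zw.
Qed.

Variable Z : hpath A T.
Let N := level alpha.
Hypothesis N0 : (0 < N)%N.
Hypothesis spanZ : path_in_span N.-1 Z.
Hypothesis boundedZ : (cnorm alpha beta X Z < +oo)%E.

(** An increment of [Z] is a remainder plus the effect of a transport near the identity, and the
    latter depends on the size of [Z s]. A first pass from time 0 bounds [Z] uniformly by [M1]; a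
    second pass, from any time, uses that bound. *)
Lemma controlled_path_holder h : exists M, [/\ 0 <= M,
  forall t, `|Z t h| <= M & forall s t, `|Z s h - Z t h| <= M * dist s t `^ beta].
Proof.
have [hN|hN] := leqP (fsize h) N.-1; last first.
  have E t : Z t h = 0 by apply: spanZ; rewrite /forests_le /= leqNgt hN.
  by exists 0; split=> // [t|s t]; rewrite !E ?subr0 normr0 ?mul0r.
have /cnorm_ltyP[K RK] := boundedZ.
pose P k B := forall s t, `|remainder alpha X Z k s t| <= B * dist s t `^ beta.
have mono k a b : a <= b -> P k a -> P k b.
  by move=> ab Pa s t; apply: (le_trans (Pa s t)); rewrite ler_wpM2r ?powR_ge0.
have ex k : k \in forest_seq A N.-1 -> exists B, P k B.
  rewrite mem_forest_seq => kN.
  have bk : beta <= (N - fsize k)%N%:R * beta.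
    by rewrite ler_peMl ?(ltW beta0) // ler1n subn_gt0 -(prednK N0) ltnS.
  have RK' := hbounded_exp bk (RK k kN).
  eexists => s t; have [<-|st] := eqVneq s t; last exact: RK'.
  rewrite remainderE (transport_diag s (Z s) bX kN) ?subrr ?normr0.
  by rewrite mulr_ge0 ?powR_ge0 ?(hbounded_ge0 RK').
have [B B1 RB] := seq_bound mono ex.
have B0 : 0 <= B by lra.
have [C C0 near] := transport_near_unit N.-1.
pose w := \sum_(k <- forest_seq A N.-1) `|Z (time0 T) k|.
have w0 : 0 <= w by exact: sumr_ge0.
have Zw k : (fsize k <= N.-1)%N -> `|Z (time0 T) k| <= w.
  move=> kN; rewrite /w (bigD1_seq k) ?forest_seq_uniq ?mem_forest_seq //=.
  by rewrite lerDl sumr_ge0.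
have incr w' s t k : 0 <= w' -> (forall l, (fsize l <= N.-1)%N -> `|Z s l| <= w') ->
    (fsize k <= N.-1)%N -> `|Z t k - Z s k| <= (B + C * w') * dist s t `^ beta.
  move=> w'0 Zw' kN; rewrite mulrDl.
  rewrite (_ : _ - _ = remainder alpha X Z k s t +
    (transport N.-1 (X s t) (Z s) k - Z s k)); last by rewrite remainderE; ring.
  apply: (le_trans (ler_normD _ _)); apply: lerD; last exact: near.
  by apply: RB; rewrite mem_forest_seq.
pose M1 := (B + C * w) * T%:num `^ beta + w.
have M10 : 0 <= M1 by rewrite !(addr_ge0, mulr_ge0) ?powR_ge0.
have ZM t k : (fsize k <= N.-1)%N -> `|Z t k| <= M1.
  move=> kN; rewrite -[Z t k](subrK (Z (time0 T) k)).
  apply: (le_trans (ler_normD _ _)); apply: lerD; last exact: Zw.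
  apply: (le_trans (incr w _ _ _ w0 Zw kN)); rewrite ler_wpM2l ?addr_ge0 ?mulr_ge0 //.
  by rewrite powR_le_base ?(ltW beta0) ?dist_ge0 ?dist_le.
exists (M1 + (B + C * M1)); split=> [|t|s t].
- by rewrite !(addr_ge0, mulr_ge0).
- by apply: (le_trans (ZM t h hN)); rewrite lerDl addr_ge0 ?mulr_ge0.
- rewrite distC; apply: (le_trans (incr M1 _ _ _ M10 (ZM t) hN)).
  by rewrite ler_wpM2r ?powR_ge0 // lerDr.
Qed.

Lemma remainder_holder_continuous h : holder_continuous beta (remainder alpha X Z h).
Proof.
have hZs k : holder_continuous beta (fun s _ => Z s k).
  have [M [M0 ZM ZM']] := controlled_path_holder k; exists M; split=> // s t s' t'.
  by apply: (le_trans (ZM' s s')); rewrite ler_wpM2l // lerDl powR_ge0.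
have hZt k : holder_continuous beta (fun _ t => Z t k).
  have [M [M0 ZM ZM']] := controlled_path_holder k; exists M; split=> // s t s' t'.
  by apply: (le_trans (ZM' t t')); rewrite ler_wpM2l // lerDr powR_ge0.
have hR : holder_continuous beta (fun s t => Z t h + -1 *
    \sum_(k <- forest_seq A N.-1) \sum_(p <- coprod k | p.2 == h) X s t p.1 * Z s k).
  apply: holder_continuousD => //.
  apply: holder_continuousM; first exact: holder_continuous_cst.
  apply: holder_continuous_sum => k; apply: holder_continuous_sum => p.
  by apply: holder_continuousM => //; exact: rough_holder_continuous.
have E s t : remainder alpha X Z h s t = Z t h + -1 *
    \sum_(k <- forest_seq A N.-1) \sum_(p <- coprod k | p.2 == h) X s t p.1 * Z s k.
  by rewrite remainderE transportE mulN1r.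
by have [C [C0 b1 b2]] := hR; exists C; split=> // *; rewrite !E; [exact: b1|exact: b2].
Qed.

End RoughHolderContinuity.

(** The dense set contains, for every scale 1/(n+1) and every code, one point carrying that code at
    that scale, if there is any, and the default [x0] otherwise. *)
Lemma separable_code (R : realType) (S : Type) (K : countType) (E : set S)
    (d : S -> S -> \bar R) (code : R -> S -> K -> Prop) :
  (forall e x, 0 < e -> E x -> exists c, code e x c) ->
  (forall e x y c, 0 < e -> E x -> E y -> code e x c -> code e y c ->
     (d x y < e%:E)%E) ->
  separable_on E d.
Proof.
move=> ex cl; have [E0|] := pselect (E = set0).
  by exists set0; split=> // x; rewrite E0.
move=> /eqP/set0P[x0 Ex0].
have sel (q : nat * K) : exists x, E x /\
    ((exists y, E y /\ code q.1.+1%:R^-1 y q.2) -> code q.1.+1%:R^-1 x q.2).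
  have [[y [Ey cy]]|no] := pselect (exists y, E y /\ code q.1.+1%:R^-1 y q.2).
    by exists y.
  by exists x0; split.
have [f fP] := choice sel.
exists (range f); split=> [_ [q _ <-]||x Ex e e0]; first by have [] := fP q.
  exact: (sub_countable (card_image_le f setT) (countableP _)).
pose n := Num.truncn e^-1.
have ne : n.+1%:R^-1 < e.
  rewrite invf_plt ?posrE ?ltr0n //.
  by have /truncn_itv/andP[] : 0 <= e^-1 by rewrite invr_ge0 ltW.
have n0 : 0 < n.+1%:R^-1 :> R by rewrite invr_gt0 ltr0n.
have [c cx] := ex _ x n0 Ex.
exists (f (n, c)); first by exists (n, c).
have [Ef cf] := fP (n, c).
apply: lt_trans (cl _ x (f (n, c)) c n0 Ex Ef cx (cf _)) _; last by rewrite lte_fin.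
by exists x.
Qed.

(** * Rounding on a grid *)

Section Rounding.
Variables (R : realType) (T : {posnum R}).
Implicit Types (F G : time T -> time T -> R) (s t : time T) (g e d eta : R).

Definition mesh m : R := T%:num / m.+1%:R.

Lemma mesh_gt0 m : 0 < mesh m.
Proof. by rewrite divr_gt0 ?ltr0n. Qed.

Lemma mesh_small d : 0 < d -> exists m0, forall m, (m0 <= m)%N -> mesh m <= d.
Proof.
move=> d0; exists (Num.truncn (T%:num / d)) => m le.
rewrite /mesh ler_pdivrMr ?ltr0n // mulrC -ler_pdivrMr //.
have /truncn_itv/andP[_ /ltW lt] : 0 <= T%:num / d by rewrite divr_ge0 // ltW.
by apply: (le_trans lt); rewrite ler_nat.
Qed.

Definition node m i : time T := grid T (ltn0Sn m) i.

Lemma node_near m t : exists2 i, i \in iota 0 m.+1 & dist t (node m i) <= mesh m.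
Proof.
have [i im] : exists2 i, (i < m.+1)%N & i%:R * mesh m <= val t <= i.+1%:R * mesh m.
  by apply: cell_exists => //; rewrite /mesh mulrC divfK ?pnatr_eq0 //; exact: (valP t).
rewrite -natr1 mulrDl mul1r => /andP[it ti]; exists i; first by rewrite mem_iota.
have vi : val (node m i) = i%:R * mesh m by apply: val_grid; exact: ltnW.
by rewrite /dist vi distrC ger0_norm ?subr_ge0 // lerBlDl.
Qed.

Definition small_at d g e F := forall s t, s != t -> dist s t <= d ->
  `|F s t| <= e * dist s t `^ g.

Definition oscillation_le d eta F := forall s t s' t', dist s s' <= d ->
  dist t t' <= d -> `|F s t - F s' t'| <= eta.

Definition rounding m eta F : seq (seq int) :=
  [seq [seq Num.floor (F (node m i) (node m j) / eta) | j <- iota 0 m.+1]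
      | i <- iota 0 m.+1].

Lemma floor_close (a b eta : R) : 0 < eta ->
  Num.floor (a / eta) = Num.floor (b / eta) -> `|a - b| <= eta.
Proof.
move=> eta0 ab; have /andP[a1 a2] := floor_itv (a / eta).
have /andP[b1 b2] := floor_itv (b / eta).
have : `|a / eta - b / eta| <= 1.
  move: a1 a2 b1 b2; rewrite ab intrD; set c := (_%:~R) => *.
  by rewrite ler_norml; apply/andP; split; lra.
by rewrite -mulrBl normrM (gtr0_norm (_ : 0 < eta^-1)) ?invr_gt0 // ler_pdivrMr // mul1r.
Qed.

(** Up to distance [d] both functions are small. Beyond it they are compared at nearby nodes, and
    [eta = e * Num.min 1 d] is at most e |t-s|^g: for |t-s| below 1 this uses that [g] is at most
    1. *)
Lemma rounding_close m d g e F G : 0 <= g <= 1 -> 0 < e -> 0 < d ->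
  small_at d g e F -> small_at d g e G ->
  oscillation_le (mesh m) (e * Num.min 1 d) F ->
  oscillation_le (mesh m) (e * Num.min 1 d) G ->
  rounding m (e * Num.min 1 d) F = rounding m (e * Num.min 1 d) G ->
  hbounded g (3 * e) (fun s t => F s t - G s t).
Proof.
move=> /andP[g0 g1] e0 d0 sF sG; set eta := e * _ => oF oG FG s t st.
have st0 : 0 < dist s t by rewrite dist_gt0.
have [le|lt] := leP (dist s t) d.
  apply: (le_trans (ler_normB _ _)); apply: (le_trans (lerD (sF s t st le) (sG s t st le))).
  by rewrite -mulrDl ler_wpM2r ?powR_ge0 //; lra.
have m0 : 0 < Num.min 1 d by rewrite lt_min ltr01.
have eta0 : 0 < eta by rewrite mulr_gt0.
have [i ir si] := node_near m s; have [j jr tj] := node_near m t.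
have /eq_in_map/(_ j jr) E := (eq_in_map _ _ _).2 FG i ir.
have F1 := oF _ _ _ _ si tj; have G1 := oG _ _ _ _ si tj.
have FG1 := floor_close eta0 E.
(* One [eta] for moving [F] to the node, one for the rounding, one for moving [G] back. *)
apply: (@le_trans _ _ (3 * eta)).
  move: F1 G1 FG1; rewrite !ler_norml => /andP[? ?] /andP[? ?] /andP[? ?].
  by apply/andP; split; lra.
rewrite /eta mulrA ler_wpM2l //; first by rewrite mulr_ge0 // ltW.
have [one|one] := leP 1 (dist s t).
  apply: (@le_trans _ _ 1); first by rewrite ge_min lexx.
  by have := powR_le_base g0 ler01 one; rewrite powR1.
apply: (@le_trans _ _ (dist s t)); first by rewrite ge_min (ltW lt) orbT.
by apply: ger1_powR => //; rewrite st0 ltW.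
Qed.

End Rounding.

(** * The total space *)

Section FlatMetric.
Variables (R : realType) (A : finType) (T : {posnum R}) (alpha beta : R).
Hypotheses (A_gt0 : (0 < #|A|)%N) (alpha01 : 0 < alpha < 1).
Hypothesis alphaN : forall n : nat, (0 < n)%N -> alpha <> 1 / n%:R.
Hypothesis beta_alpha : 0 < beta < alpha.
Let N := level alpha.
Implicit Types (x y : process A T * hpath A T) (h k : forest A) (g e : R).
Implicit Types (C E : set (process A T)).

Let alpha0 : 0 < alpha. Proof. by case/andP: alpha01. Qed.
Let alpha1 : alpha < 1. Proof. by case/andP: alpha01. Qed.
Let beta0 : 0 < beta. Proof. by case/andP: beta_alpha. Qed.
Let ba : beta < alpha. Proof. by case/andP: beta_alpha. Qed.
Let N0 : (0 < N)%N. Proof. by have [] := level_itv alpha01 alphaN. Qed.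
Let Nalpha : N%:R * alpha < 1. Proof. by have [] := level_itv alpha01 alphaN. Qed.
Let levelN : 1 < alpha * N.+1%:R. Proof. by have [] := level_itv alpha01 alphaN. Qed.

Let branched := @branched_rough_paths R A T alpha.
Let geometric := @geometric_rough_paths R A T alpha.

Lemma hbounded0_eq g (F G : time T -> time T -> R) :
  (forall e, 0 < e -> hbounded g e (fun s t => F s t - G s t)) ->
  forall s t, s != t -> F s t = G s t.
Proof.
move=> FG s t st; apply/eqP; rewrite -subr_eq0 -normr_le0; apply/ler_addgt0Pr => e e0.
rewrite add0r; have w0 : 0 < dist s t `^ g by rewrite powR_gt0 ?dist_gt0.
by apply: (le_trans (FG _ (divr_gt0 e0 w0) s t st)); rewrite divfK // gt_eqF.
Qed.

(* Applied to the sequence alternating between two rough paths, the propagation of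
   Cauchyness to all levels says that the levels up to N determine the others. *)
Lemma branched_ext (X Y : process A T) : branched X -> branched Y ->
  (forall e, 0 < e -> forall h, h != fone -> (fsize h <= N)%N ->
     hbounded ((fsize h)%:R * alpha) e (fun s t => X s t h - Y s t h)) -> X = Y.
Proof.
move=> bX bY XY; pose u n := if odd n then X else Y.
have bu n : branched_rough_paths alpha (u n) by rewrite /u; case: odd.
have cu e : 0 < e -> exists n0, forall m n, (n0 <= m)%N -> (n0 <= n)%N ->
    forall h, h != fone -> (fsize h <= N)%N ->
    hbounded ((fsize h)%:R * alpha) e (fun s t => u m s t h - u n s t h).
  move=> e0; exists 0%N => m n _ _ h h1 hN s t st.
  have z : 0 <= e * dist s t `^ ((fsize h)%:R * alpha) by rewrite mulr_ge0 ?powR_ge0 ?ltW.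
  rewrite /u; case: odd; case: odd; rewrite ?subrr ?normr0 //; first exact: XY.
  by rewrite distrC; exact: XY.
apply/funext => s; apply/funext => t; apply/funext => h.
have [<-|st] := eqVneq s t; first by rewrite (branched_diag s bX) (branched_diag s bY).
apply: (@hbounded0_eq (alpha * (fsize h)%:R) (fun s t => X s t h) (fun s t => Y s t h)) => // e e0.
have [n0 le] := cauchy_all_levels alpha0 levelN bu cu h e0.
have := le n0.*2 _ n0.*2.+1 _; rewrite /u /= odd_double; apply; rewrite -addnn ?leq_addr //.
by rewrite -addnS leq_addr.
Qed.

(** Once the rough paths coincide, the initial value and the remainder from time 0 determine the
    controlled path. *)
Lemma close0_eq g x y : branched x.1 -> branched y.1 ->
  path_in_span N.-1 x.2 -> path_in_span N.-1 y.2 ->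
  (forall e, 0 < e -> close alpha g e x y) -> x = y.
Proof.
case: x y => [X Z] [Y W] /= bX bY sZ sW cl.
have XY : X = Y by apply: branched_ext => // e /cl[].
subst Y; congr (_, _); apply/funext => t; apply/funext => h.
have [hN|hN] := leqP (fsize h) N.-1; last first.
  by rewrite sZ ?sW //; rewrite /forests_le /= leqNgt hN.
have Z0 k : (fsize k <= N.-1)%N -> Z (time0 T) k = W (time0 T) k.
  move=> kN; apply/eqP; rewrite -subr_eq0 -normr_le0; apply/ler_addgt0Pr => e e0.
  by rewrite add0r; have [_ /(_ k kN)] := cl _ e0.
have [<-|t0] := eqVneq (time0 T) t; first exact: Z0.
have := @hbounded0_eq ((N - fsize h)%N%:R * g) (remainder alpha X Z h) (remainder alpha X W h).
move=> /(_ _ _ _ t0); rewrite !remainderE.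
rewrite (eq_transport (X (time0 T) t) h (y := Z (time0 T)) (z := W (time0 T))) //.
by move=> /(_ _)/addIr; apply=> e /cl[_ _]; apply.
Qed.

Section Subspace.
Variables (C : set (process A T)) (g : R).
Hypothesis C_branched : C `<=` branched.
Let F := total_space C alpha beta.

Let F_branched x : F x -> branched x.1. Proof. by case=> /C_branched. Qed.
Let F_span x : F x -> path_in_span N.-1 x.2. Proof. by case=> _ []. Qed.

Lemma flat_extended_metric : extended_metric_on F (flat_dist alpha g).
Proof.
split=> [x y _ _|x y Fx Fy|x y _ _|x y z _ _ _].
- by rewrite adde_ge0 ?rho_ge0 ?cdist_ge0.
- split=> [d0|->].
    apply: (@close0_eq g); [exact: F_branched|exact: F_branched|exact: F_span|exact: F_span|].
    by move=> e e0; apply: flat_dist_lt_close => //; rewrite d0 lte_fin.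
  apply/eqP; rewrite eq_le; apply/andP; split; last first.
    by rewrite adde_ge0 ?rho_ge0 ?cdist_ge0.
  have /close_flat_dist_le : close alpha g 0 y y.
    by split=> h *; rewrite ?subrr ?normr0 // => s t _; rewrite subrr normr0 mul0r.
  by rewrite mul0r.
- by rewrite /flat_dist rhoC cdistC.
- rewrite /flat_dist addeACA; apply: leeD; first exact: rho_triangle.
  exact: cdist_triangle.
Qed.

Lemma close_dist_lt e x y :
  close alpha g (e / 2 / flat_const A alpha) x y -> 0 < e ->
  (flat_dist alpha g x y < e%:E)%E.
Proof.
move=> cl e0; apply: le_lt_trans (close_flat_dist_le cl) _.
by rewrite divfK ?gt_eqF ?flat_const_gt0 // lte_fin; lra.
Qed.

Hypothesis beta_g : beta <= g.
Hypothesis C_closed : forall (X_ : nat -> process A T) X,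
  (forall n, C (X_ n)) -> branched X ->
  (forall e, 0 < e -> exists n, (rho alpha (X_ n) X <= e%:E)%E) -> C X.

(** The limit stays in the total space because [C] is closed and because the little-o condition,
    which characterizes the fibres, passes to the limit. *)
Lemma flat_complete : complete_on F (flat_dist alpha g).
Proof.
move=> u Fu cau; pose X_ n := (u n).1; pose Z_ n := (u n).2.
have cl e : 0 < e -> exists n0, forall m n, (n0 <= m)%N -> (n0 <= n)%N ->
    close alpha g e (u m) (u n).
  move=> /cau[n0 le]; exists n0 => m n mn nn.
  by apply: flat_dist_lt_close => //; exact: le.
have bX n : branched_rough_paths alpha (X_ n) by exact: F_branched.
have sZ n : path_in_span N.-1 (Z_ n) by exact: F_span.
have cX e : 0 < e -> exists n0, forall m n, (n0 <= m)%N -> (n0 <= n)%N ->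
    forall h, h != fone -> (fsize h <= N)%N ->
    hbounded ((fsize h)%:R * alpha) e (fun s t => X_ m s t h - X_ n s t h).
  by move=> /cl[n0 le]; exists n0 => m n mn nn; have [] := le m n mn nn.
have cZ e : 0 < e -> exists n0, forall m n, (n0 <= m)%N -> (n0 <= n)%N ->
    forall h, (fsize h <= N.-1)%N -> `|Z_ m (time0 T) h - Z_ n (time0 T) h| <= e.
  by move=> /cl[n0 le]; exists n0 => m n mn nn; have [] := le m n mn nn.
have cR e : 0 < e -> exists n0, forall m n, (n0 <= m)%N -> (n0 <= n)%N ->
    forall h, (fsize h <= N.-1)%N -> hbounded ((N - fsize h)%N%:R * g) e (fun s t =>
      remainder alpha (X_ m) (Z_ m) h s t - remainder alpha (X_ n) (Z_ n) h s t).
  by move=> /cl[n0 le]; exists n0 => m n mn nn; have [] := le m n mn nn.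
pose X := rough_limit X_; pose Z := controlled_limit Z_.
have bX' : branched X := rough_limit_branched alpha0 levelN bX cX.
have conv := controlled_limit_close alpha0 levelN bX cX sZ cZ cR.
exists (X, Z); last first.
  move=> e e0; have c0 := divr_gt0 (divr_gt0 e0 (ltr0n R 2)) (flat_const_gt0 A alpha).
  have [n0 le] := conv _ c0; exists n0 => n /le {}le.
  by apply: close_dist_lt => //; move: le; rewrite -surjective_pairing.
split=> /=.
  apply: (C_closed (X_ := X_)) => // [n|e /conv[n0 /(_ n0 (leqnn _))[cl' _ _]]].
    by have [] := Fu n.
  by exists n0; apply/rho_leP.
apply: small_controlled_closure => //; [exact: ltW|exact: ltW|exact: ltW|..].
  exact: controlled_limit_span.
apply: (remainder_small_limit beta_g) conv => n.
by apply: controlled_closure_small => //; have [] := Fu n.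
Qed.

End Subspace.

Lemma geometric_closed (X_ : nat -> process A T) X :
  (forall n, geometric (X_ n)) -> branched X ->
  (forall e, 0 < e -> exists n, (rho alpha (X_ n) X <= e%:E)%E) -> geometric X.
Proof.
move=> gX bX conv; split=> // e e0; have e2 : 0 < e / 2 by rewrite divr_gt0.
have [n le] := conv _ e2; have [_ /(_ _ e2)[x [Y [sx lY lt]]]] := gX n.
exists x, Y; split=> //; apply: le_lt_trans (rho_triangle alpha (X_ n) X Y) _.
rewrite rhoC in le; apply: le_lt_trans (leeD2r _ le) _.
by rewrite [X in (_ < X%:E)%E](splitr e) EFinD lteD2lE.
Qed.

Lemma flat_dist_finite x y : branched x.1 -> branched y.1 ->
  controlled_closure alpha beta x.1 x.2 -> controlled_closure alpha beta y.1 y.2 ->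
  (flat_dist alpha beta x y < +oo)%E.
Proof.
move=> bX bY cZ cW; apply: lte_add_pinfty.
  have [K K1 XK] := branched_bound N bX; have [L L1 YL] := branched_bound N bY.
  apply: (@le_lt_trans _ _ (K + L)%:E); last exact: ltry.
  apply/rho_leP => h h1 hN; rewrite mulrC.
  by apply: hboundedB => s t _; [exact: XK|exact: YL].
have /cnorm_ltyP[K ZK] := controlled_closure_bounded ba cZ.
have /cnorm_ltyP[L WL] := controlled_closure_bounded ba cW.
pose w := \sum_(h <- forest_seq A N.-1) `|x.2 (time0 T) h - y.2 (time0 T) h|.
have w0 : 0 <= w by exact: sumr_ge0.
have K0 : 0 <= K by apply: (hbounded_ge0 (ZK fone _)); rewrite fsize1.
have L0 : 0 <= L by apply: (hbounded_ge0 (WL fone _)); rewrite fsize1.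
apply: (@le_lt_trans _ _ ((w + (K + L)) * (2 * size (forest_seq A N.-1))%:R)%:E).
  apply: close_cdist_le => h hN.
    apply: (@le_trans _ _ w); last by rewrite lerDl addr_ge0.
    rewrite /w (bigD1_seq h) ?forest_seq_uniq ?mem_forest_seq //=.
    by rewrite lerDl sumr_ge0.
  apply: (@hbounded_le _ _ _ (K + L)); first by rewrite lerDr.
  by apply: hboundedB; [exact: ZK|exact: WL].
exact: ltry.
Qed.

Section Separable.

(** The coordinates entering the distance: [true] marks a component of the rough path, [false] a
    remainder of the controlled path. *)
Let idx : seq (bool * forest A) :=
  [seq (true, h) | h <- forest_seq A N & h != fone] ++
  [seq (false, h) | h <- forest_seq A N.-1].

Let coordinate x (i : bool * forest A) : time T -> time T -> R :=
  if i.1 then fun s t => x.1 s t i.2 else remainder alpha x.1 x.2 i.2.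

Let expo (i : bool * forest A) : R :=
  if i.1 then (fsize i.2)%:R * alpha else (N - fsize i.2)%N%:R * beta.

(** The index of the scale below which the coordinates are small, the index of the grid, the rounded
    coordinates and the rounded initial values. *)
Let code_type : countType := (nat * nat * seq (seq (seq int)) * seq int)%type.

Let coded e x (c : code_type) : Prop := let: (m1, m2, l, l0) := c in
  let eta := e * Num.min 1 (mesh T m1) in
  [/\ forall i, i \in idx -> small_at (mesh T m1) (expo i) e (coordinate x i),
      forall i, i \in idx -> oscillation_le (mesh T m2) eta (coordinate x i),
      l = [seq rounding m2 eta (coordinate x i) | i <- idx]
    & l0 = [seq Num.floor (x.2 (time0 T) h / e) | h <- forest_seq A N.-1]].

Lemma expo_itv i : i \in idx -> 0 <= expo i <= 1.
Proof.
rewrite mem_cat => /orP[] /mapP[h]; rewrite ?mem_filter mem_forest_seq.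
  move=> /andP[_ hN] ->; rewrite /expo /= mulr_ge0 ?(ltW alpha0) //=.
  by apply: le_trans (ltW Nalpha); rewrite ler_pM2r // ler_nat.
move=> hN ->; rewrite /expo /= mulr_ge0 ?(ltW beta0) //=.
apply: le_trans (ltW Nalpha); apply: ler_pM; rewrite ?(ltW beta0) ?(ltW ba) //.
by rewrite ler_nat leq_subr.
Qed.

Let Eg := total_space geometric alpha beta.

(** Geometricity serves the rough path coordinates, and membership in the closure serves the
    remainders. *)
Lemma coordinate_small x e : Eg x -> 0 < e -> exists m, forall i, i \in idx ->
  small_at (mesh T m) (expo i) e (coordinate x i).
Proof.
move=> [gX cZ] e0; have [d1 d10 X1] := geometric_small alpha1 gX e0.
have [d2 d20 Z2] := controlled_closure_small N0 ba cZ e0.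
have [m1 le1] := mesh_small T d10; have [m2 le2] := mesh_small T d20.
exists (maxn m1 m2) => i; rewrite mem_cat => /orP[] /mapP[h]; rewrite ?mem_filter mem_forest_seq.
  move=> /andP[h1 hN] -> s t st le; apply: X1 => //.
  by apply: (le_trans le); apply: le1; rewrite leq_maxl.
move=> hN -> s t st le; apply: Z2 => //.
by apply: (le_trans le); apply: le2; rewrite leq_maxr.
Qed.

Lemma coordinate_oscillation x e : Eg x -> 0 < e -> exists m, forall i, i \in idx ->
  oscillation_le (mesh T m) e (coordinate x i).
Proof.
move=> [[bX _] cZ] e0; have fZ := controlled_closure_bounded ba cZ; have [sZ _] := cZ.
have hc i : holder_continuous beta (coordinate x i).
  rewrite /coordinate; case: i.1.
    by apply: (rough_holder_continuous beta0 (ltW ba)).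
  exact: (remainder_holder_continuous beta0 (ltW ba)).
have [i _|m0 osc] := @seq_eventually _ idx
    (fun i m => oscillation_le (mesh T m) e (coordinate x i)).
  have [d d0 le] := holder_continuous_uniform beta0 (hc i) e0.
  have [m0 lem] := mesh_small T d0; exists m0 => m /lem {}lem s t s' t' ss' tt'.
  by apply: le; [exact: le_trans ss' lem|exact: le_trans tt' lem].
by exists m0 => i; exact: osc.
Qed.

Lemma coded_close e x y c : 0 < e -> coded e x c -> coded e y c ->
  close alpha beta (3 * e) x y.
Proof.
move: c => [[[m1 m2] l] l0] e0 [sx ox lx zx] [sy oy ly zy].
have /eq_in_map E : [seq rounding m2 (e * Num.min 1 (mesh T m1)) (coordinate x i) | i <- idx] =
    [seq rounding m2 (e * Num.min 1 (mesh T m1)) (coordinate y i) | i <- idx].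
  by rewrite -lx -ly.
have /eq_in_map E0 : [seq Num.floor (x.2 (time0 T) h / e) | h <- forest_seq A N.-1] =
    [seq Num.floor (y.2 (time0 T) h / e) | h <- forest_seq A N.-1].
  by rewrite -zx -zy.
have bnd i : i \in idx -> hbounded (expo i) (3 * e)
    (fun s t => coordinate x i s t - coordinate y i s t).
  move=> ii; apply: (rounding_close (expo_itv ii) e0 (mesh_gt0 T m1) (sx i ii) (sy i ii)
    (ox i ii) (oy i ii)).
  exact: E.
split=> h.
- move=> h1 hN; apply: (bnd (true, h)).
  by rewrite mem_cat map_f // mem_filter h1 mem_forest_seq.
- move=> hN; apply: (@le_trans _ _ e); last by lra.
  by apply: floor_close => //; apply: E0; rewrite mem_forest_seq.
- move=> hN; apply: (bnd (false, h)).
  by rewrite mem_cat [X in _ || X]map_f ?orbT // mem_forest_seq.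
Qed.

Lemma geometric_separable : separable_on Eg (flat_dist alpha beta).
Proof.
(* The 3 compensates [coded_close], [flat_const] the passage to the distance, and the 2 makes the
   final inequality strict. *)
pose r e := e / 2 / flat_const A alpha / 3.
have r0 e : 0 < e -> 0 < r e.
  by move=> e0; rewrite !divr_gt0 ?flat_const_gt0.
apply: (separable_code (code := fun e => coded (r e))) => [e x e0 Ex|e x y c e0 Ex Ey cx cy].
  have [m1 small] := coordinate_small Ex (r0 e e0).
  have eta0 : 0 < r e * Num.min 1 (mesh T m1).
    by rewrite mulr_gt0 ?r0 // lt_min ltr01 mesh_gt0.
  have [m2 osc] := coordinate_oscillation Ex eta0.
  by eexists (m1, m2, _, _); split; [exact: small|exact: osc|reflexivity|reflexivity].
apply: close_dist_lt => //; have := coded_close (r0 e e0) cx cy.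
by rewrite /r [3 * _]mulrC divfK // pnatr_eq0.
Qed.

End Separable.

End FlatMetric.

Theorem theorem4p18 (R : realType) (A : finType) (A_gt0 : (0 < #|A|)%N)
    (T : {posnum R}) (alpha beta : R)
    (alpha01 : 0 < alpha < 1)
    (alphaN : forall n : nat, (0 < n)%N -> alpha <> 1 / n%:R)
    (beta_alpha : 0 < beta < alpha) :
  let E := total_space (@branched_rough_paths R A T alpha) alpha beta in
  let Eg := total_space (@geometric_rough_paths R A T alpha) alpha beta in
  (forall F, F = E \/ F = Eg ->
     forall gamma, gamma = alpha \/ gamma = beta ->
       extended_metric_on F (flat_dist alpha gamma) /\
       complete_on F (flat_dist alpha gamma)) /\
  polish_on Eg (flat_dist alpha beta) /\
  complete_metric_on E (flat_dist alpha beta).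
Proof.
move=> E Eg; have /andP[beta0 /ltW ba] := beta_alpha.
have Eg_branched : @geometric_rough_paths R A T alpha `<=` @branched_rough_paths R A T alpha.
  by move=> X [].
have main F gamma : F = E \/ F = Eg -> gamma = alpha \/ gamma = beta ->
    extended_metric_on F (flat_dist alpha gamma) /\ complete_on F (flat_dist alpha gamma).
  move=> FE gE; have bg : beta <= gamma by case: gE => ->.
  case: FE => ->; split.
  - exact: flat_extended_metric.
  - exact: flat_complete.
  - exact: flat_extended_metric.
  - apply: flat_complete => //; exact: geometric_closed.
(* At exponent [beta] all distances are finite, so the extended metric is a metric. *)
have metric F : F = E \/ F = Eg -> complete_metric_on F (flat_dist alpha beta).
  move=> FE; have [ext cpl] := main F beta FE (or_intror erefl).
  split=> //; split=> // x y Fx Fy; case: FE Fx Fy => -> [Cx cx] [Cy cy];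
    by apply: flat_dist_finite => //; exact: Eg_branched.
split=> [F FE gamma gE|]; first exact: main.
split; last by apply: metric; left.
split; first by apply: metric; right.
exact: geometric_separable.
Qed.
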